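(* Let $\Gamma$ be a $C^2$, strictly convex, $\mathbb{D}_2$-symmetric billiard curve, and let $Z$ be one of its $\mathbb{D}_2$-symmetric $2$-periodic Birkhoff billiard orbits, with constant segment length $L$ and curvature $\kappa$ along $Z$. If $\kappa L<2$, then $\Gamma$ admits, for each of the types I, II and V, infinitely many non-Birkhoff periodic billiard orbits of rotation number $\frac12$ of that type, with arbitrarily long minimal periods.
   Context: $\mathbb{D}_2=\langle R,S\rangle$, where $R$ is rotation by $\pi$ and $S$ is the horizontal reflection. Billiard curves are $C^2$, bound strictly convex domains, and are parametrized by $1$-periodic $C^2$ immersions $\gamma$ with $\gamma(x+1/2)=R\gamma(x)$ and $\gamma(-x)=S\gamma(x)$. Billiard sequences, orbits, lifts and the Birkhoff property are as usual: a lift $x$ with $0<x_{i+1}-x_i<1$ is Birkhoff if $x_i\le x_j+l\Rightarrow x_{i+m}\le x_{j+m}+l$ for all integers. For a periodic billiard orbit $z$ of minimal period $p$: - Type I: $H(z)=\mathbb{D}_2$, $R(z_i)=z_{p/2+i}$, and $S(z_i)=z_{k-i}$ for some $k$ (so both reflections act time-reversingly). - Type II: $H(z)=\mathbb{D}_2$, $R(z_i)=z_{k-i}$ for an odd $k$, and one of $S$, $RS$ maps $z_i$ to $z_{p/2+i}$. - Type V: $H(z)=\langle\sigma\rangle$ for a single reflection $\sigma$ with $\sigma(z_i)=z_{p/2+i}$ and $\sigma(z_i)=z_{k-i}$ for some $k$. Here $H(z)$ is the set of $h\in\mathbb{D}_2$ with $h(z_i)=z_{k+i}$ for all $i$, or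 $h(z_i)=z_{k-i}$ for all $i$, for some $k$. *)

(* Defs.v *)
From Stdlib Require Import Reals ZArith.
From Coquelicot Require Import Coquelicot.
Open Scope R_scope.

Definition pt := (R * R)%type.
Definition padd (p q : pt) : pt := (fst p + fst q, snd p + snd q).
Definition psub (p q : pt) : pt := (fst p - fst q, snd p - snd q).
Definition pscal (a : R) (p : pt) : pt := (a * fst p, a * snd p).
Definition dot (p q : pt) : R := fst p * fst q + snd p * snd q.
Definition pnorm (p : pt) : R := sqrt (dot p p).
Definition pdist (p q : pt) : R := pnorm (psub q p).

Definition interior (D : pt -> Prop) (p : pt) : Prop :=
  exists r, 0 < r /\ forall q, pdist p q < r -> D q.
Definition boundary (D : pt -> Prop) (p : pt) : Prop :=
  forall r, 0 < r ->
    (exists q, pdist p q < r /\ D q) /\ (exists q, pdist p q < r /\ ~ D q).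
Definition strictly_convex (D : pt -> Prop) : Prop :=
  forall x y, D x -> D y -> x <> y -> forall t, 0 < t < 1 ->
    interior D (padd (pscal (1 - t) x) (pscal t y)).
Definition bounded (D : pt -> Prop) : Prop :=
  exists M, forall p, D p -> pnorm p <= M.

Definition cx (g : R -> pt) (t : R) : R := fst (g t).
Definition cy (g : R -> pt) (t : R) : R := snd (g t).
Definition C2fun (f : R -> R) : Prop :=
  forall t, ex_derive f t /\ ex_derive (Derive f) t /\
            continuous (Derive (Derive f)) t.
Definition tangent (g : R -> pt) (t : R) : pt :=
  (Derive (cx g) t, Derive (cy g) t).
Definition curvature (g : R -> pt) (t : R) : R :=
  Rabs (Derive (cx g) t * Derive (Derive (cy g)) t
        - Derive (cy g) t * Derive (Derive (cx g)) t)
  / (pnorm (tangent g t)) ^ 3.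

Inductive D2 := D2e | D2R | D2S | D2RS.
Definition Rot (p : pt) : pt := (- fst p, - snd p).
Definition Sref (p : pt) : pt := (fst p, - snd p).
Definition act (h : D2) (p : pt) : pt :=
  match h with
  | D2e => p
  | D2R => Rot p
  | D2S => Sref p
  | D2RS => Rot (Sref p)
  end.

Definition billiard_curve (g : R -> pt) : Prop :=
  C2fun (cx g) /\ C2fun (cy g) /\
  (forall t, tangent g t <> (0, 0)) /\
  (forall t, g (t + 1) = g t) /\
  (forall s t, 0 <= s < 1 -> 0 <= t < 1 -> g s = g t -> s = t) /\
  (exists D : pt -> Prop, bounded D /\ strictly_convex D /\
     forall p, boundary D p <-> exists t, g t = p).
Definition D2_symmetric_curve (g : R -> pt) : Prop :=
  (forall t, g (t + / 2) = Rot (g t)) /\ (forall t, g (- t) = Sref (g t)).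

Definition on_curve (g : R -> pt) (p : pt) : Prop := exists t, g t = p.
Definition unit_dir (z : Z -> pt) (i : Z) : pt :=
  pscal (/ pdist (z i) (z (i + 1)%Z)) (psub (z (i + 1)%Z) (z i)).
Definition billiard_orbit (g : R -> pt) (z : Z -> pt) : Prop :=
  (forall i, on_curve g (z i)) /\
  (forall i, z i <> z (i + 1)%Z) /\
  (forall i t, g t = z i ->
     dot (unit_dir z (i - 1)%Z) (tangent g t) = dot (unit_dir z i) (tangent g t)).

Definition is_lift (g : R -> pt) (z : Z -> pt) (x : Z -> R) : Prop :=
  forall i, g (x i) = z i /\ 0 < x (i + 1)%Z - x i < 1.
Definition birkhoff (x : Z -> R) : Prop :=
  forall i j m l : Z, x i <= x j + IZR l -> x (i + m)%Z <= x (j + m)%Z + IZR l.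
Definition birkhoff_orbit (g : R -> pt) (z : Z -> pt) : Prop :=
  exists x, is_lift g z x /\ birkhoff x.
Definition rotation_number (g : R -> pt) (z : Z -> pt) (rho : R) : Prop :=
  exists x, is_lift g z x /\
    Un_cv (fun n => (x (Z.of_nat n) - x 0%Z) / INR n) rho.
Definition periodic_min (z : Z -> pt) (p : Z) : Prop :=
  (0 < p)%Z /\ (forall i, z (i + p)%Z = z i) /\
  (forall q, (0 < q < p)%Z -> ~ (forall i, z (i + q)%Z = z i)).

Definition Hsym (z : Z -> pt) (h : D2) : Prop :=
  (exists k, forall i, act h (z i) = z (k + i)%Z) \/
  (exists k, forall i, act h (z i) = z (k - i)%Z).
Definition D2_symmetric_orbit (z : Z -> pt) : Prop := forall h, Hsym z h.

Definition typeI (z : Z -> pt) (p : Z) : Prop :=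
  D2_symmetric_orbit z /\
  (forall i, act D2R (z i) = z (p / 2 + i)%Z) /\
  (exists k, forall i, act D2S (z i) = z (k - i)%Z).
Definition typeII (z : Z -> pt) (p : Z) : Prop :=
  D2_symmetric_orbit z /\
  (exists k, Z.odd k = true /\ forall i, act D2R (z i) = z (k - i)%Z) /\
  ((forall i, act D2S (z i) = z (p / 2 + i)%Z) \/
   (forall i, act D2RS (z i) = z (p / 2 + i)%Z)).
Definition typeV (z : Z -> pt) (p : Z) : Prop :=
  exists s, (s = D2S \/ s = D2RS) /\
    (forall h, Hsym z h <-> (h = D2e \/ h = s)) /\
    (forall i, act s (z i) = z (p / 2 + i)%Z) /\
    (exists k, forall i, act s (z i) = z (k - i)%Z).

Inductive orbit_type := TypeI | TypeII | TypeV.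
Definition has_type (T : orbit_type) (z : Z -> pt) (p : Z) : Prop :=
  match T with
  | TypeI => typeI z p
  | TypeII => typeII z p
  | TypeV => typeV z p
  end.

(* Main.v *)
Require Import Defs.
From Stdlib Require Import Reals ZArith Lra Lia ClassicalEpsilon.
From Coquelicot Require Import Coquelicot.
Open Scope R_scope.

(** The orbit [Z0] consists of the two points of the curve on one axis of symmetry; let [0] be
    the parameter of one of them. Writing a lift as [i / 2 + y i], the orbits with [-1/4 < y i
    < 1/4] are the critical points of the sum of the chords [|gamma (y i) + gamma (y (i +
    1))|], and the sought orbits are librations of [y] around the equilibrium [y = 0], odd in
    [i] and of long period. By symmetry it is enough to find a quarter (or a half) of such an
    oscillation, and this is a maximizer of the sum over [0 <= y i <= 1/4] with [y 0 = 0] and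
    an end term at the last vertex: the abscissa for type I, the distance to the center for
    type II, nothing for type V. The two axes are barriers, so the maximizer is interior unless
    it vanishes. The condition [kappa L < 2] implies that the distance to the center has a strict
    local minimum at [0]: a constant path [y i = e > 0] then beats [y = 0] as soon as it is
    long enough. The librations cross the lift of [Z0], whence they are not Birkhoff. *)

(** * Constrained maximization of path sums *)

Fixpoint path_sum (A : R -> R -> R) (n : nat) (y : nat -> R) : R :=
  match n with
  | O => 0
  | S k => path_sum A k y + A (y k) (y (S k))
  end.

Lemma path_sum_ext (A : R -> R -> R) (n : nat) (y w : nat -> R) :
  (forall i, (i <= n)%nat -> y i = w i) -> path_sum A n y = path_sum A n w.
Proof.
  induction n as [|n IH]; intros H; simpl; auto.
  rewrite IH by (intros; apply H; lia).
  rewrite (H n), (H (S n)) by lia. reflexivity.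
Qed.

(* Bellman's principle: the last vertex is eliminated by passing from the end cost [B] to the
   value function, which is again continuous. *)
Lemma path_sum_max (A : R -> R -> R) (lo hi : R) :
  lo <= hi ->
  (forall a b, continuity_pt (A a) b) ->
  (forall a e, 0 < e -> exists d, 0 < d /\
     forall a' b, Rabs (a' - a) < d -> Rabs (A a' b - A a b) < e) ->
  forall (n : nat) (B : R -> R) (a : R), (forall b, continuity_pt B b) ->
  exists y : nat -> R, y O = a /\
    (forall i, (1 <= i <= n)%nat -> lo <= y i <= hi) /\
    forall w : nat -> R, w O = a ->
      (forall i, (1 <= i <= n)%nat -> lo <= w i <= hi) ->
      path_sum A n w + B (w n) <= path_sum A n y + B (y n).
Proof.
  intros Hlh Hcont Hunif n.
  induction n as [|n IH]; intros B a HB.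
  - exists (fun _ => a). repeat split; try (intros; lia).
    intros w Hw _. simpl. rewrite Hw. lra.
  - assert (Hmax : forall s, exists c, (lo <= c <= hi) /\
        forall b, lo <= b <= hi -> A s b + B b <= A s c + B c).
    { intros s.
      destruct (continuity_ab_maj (fun b => A s b + B b) lo hi Hlh) as [c [Hc1 Hc2]].
      - intros b _. apply (continuity_pt_plus (A s) B); auto.
      - exists c. split; auto. }
    set (c := fun s => proj1_sig (constructive_indefinite_description _ (Hmax s))).
    assert (Hc : forall s, (lo <= c s <= hi) /\
        forall b, lo <= b <= hi -> A s b + B b <= A s (c s) + B (c s))
      by (intros s; exact (proj2_sig (constructive_indefinite_description _ (Hmax s)))).
    destruct (IH (fun s => A s (c s) + B (c s)) a) as [y [Hy0 [Hy1 Hy2]]].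
    (* The choice [c] may jump, but the value function is continuous: [c s] and [c s'] are
       admissible for each other's starting point, and both exchanges change the cost by less than
       [e]. *)
    { intros s e He. destruct (Hunif s e He) as [d [Hd Hs]].
      exists d. split; [exact Hd|]. intros s' [_ Hs']. simpl in *.
      unfold R_dist in *.
      pose proof (Hs s' (c s) Hs') as H1. pose proof (Hs s' (c s') Hs') as H2.
      pose proof (proj2 (Hc s) (c s') (proj1 (Hc s'))) as H3.
      pose proof (proj2 (Hc s') (c s) (proj1 (Hc s))) as H4.
      apply Rabs_def2 in H1. apply Rabs_def2 in H2. apply Rabs_def1; lra. }
    set (y' := fun i => if Nat.eq_dec i (S n) then c (y n) else y i).
    assert (E1 : forall i, (i <= n)%nat -> y' i = y i).
    { intros i Hi. unfold y'. destruct (Nat.eq_dec i (S n)); [lia|reflexivity]. }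
    assert (E2 : y' (S n) = c (y n)).
    { unfold y'. destruct (Nat.eq_dec (S n) (S n)); [reflexivity|lia]. }
    exists y'. split; [rewrite E1 by lia; exact Hy0|]. split.
    + intros i Hi. destruct (Nat.eq_dec i (S n)) as [->|Hn].
      * rewrite E2. apply Hc.
      * rewrite E1 by lia. apply Hy1. lia.
    + intros w Hw0 Hw. simpl. rewrite (path_sum_ext A n y' y E1), E2, (E1 n) by lia.
      assert (Hwn : forall i, (1 <= i <= n)%nat -> lo <= w i <= hi)
        by (intros; apply Hw; lia).
      pose proof (Hy2 w Hw0 Hwn) as H1. simpl in H1.
      assert (Hws : lo <= w (S n) <= hi) by (apply Hw; lia).
      pose proof (proj2 (Hc (w n)) (w (S n)) Hws). lra.
Qed.

(** Only points to the right of [t] are compared, so the test also applies at the lower end of a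
    constraint interval. *)
Lemma max_derive_le (f : R -> R) (t d hi : R) :
  t < hi -> is_derive f t d -> (forall s, t <= s <= hi -> f s <= f t) -> d <= 0.
Proof.
  intros Ht Hd Hm. apply Rnot_lt_le. intros Hpos.
  apply is_derive_Reals in Hd.
  destruct (Hd (d / 2)) as [delta Hdelta]; [lra|].
  pose proof (cond_pos delta) as Hdp.
  set (h := Rmin (delta / 2) (hi - t)).
  assert (Hh : 0 < h) by (unfold h; apply Rmin_glb_lt; lra).
  assert (Hh1 : h <= delta / 2) by apply Rmin_l.
  assert (Hh2 : h <= hi - t) by apply Rmin_r.
  assert (Ha : Rabs h < delta) by (rewrite Rabs_pos_eq; lra).
  pose proof (Hdelta h ltac:(lra) Ha) as H. apply Rabs_def2 in H.
  pose proof (Hm (t + h) ltac:(lra)) as Hle.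
  assert (Hq : (f (t + h) - f t) / h <= 0).
  { unfold Rdiv. pose proof (Rinv_0_lt_compat h Hh). nra. }
  lra.
Qed.

Lemma max_derive_ge (f : R -> R) (t d lo : R) :
  lo < t -> is_derive f t d -> (forall s, lo <= s <= t -> f s <= f t) -> 0 <= d.
Proof.
  intros Ht Hd Hm.
  assert (Hopp : is_derive Ropp (- t) (-1)) by (auto_derive; [auto | lra]).
  enough (- d <= 0) by lra.
  apply (max_derive_le (fun s => f (- s)) (- t) (- d) (- lo)).
  - lra.
  - evar_last.
    + apply (is_derive_comp f Ropp (- t) d (-1)).
      * rewrite Ropp_involutive. exact Hd.
      * exact Hopp.
    + unfold scal; simpl; unfold mult; simpl. ring.
  - intros s Hs. rewrite Ropp_involutive. apply Hm. lra.
Qed.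

(** * Chords of a symmetric curve *)

(* [Y] and [X] are, up to sign, the coordinates along the tangent at parameter [0] and along
   the axis through that point; the parameters in [[0, 1/4]] trace a quarter of the curve. *)
Record symmetric_arc (X Y : R -> R) : Prop := {
  arc_dX : forall t, ex_derive X t;
  arc_dY : forall t, ex_derive Y t;
  arc_immersed : forall t, Derive X t <> 0 \/ Derive Y t <> 0;
  arc_X_opp : forall t, X (- t) = X t;
  arc_Y_opp : forall t, Y (- t) = - Y t;
  arc_X_half : forall t, X (t + / 2) = - X t;
  arc_Y_half : forall t, Y (t + / 2) = - Y t;
  arc_X_pos : forall t, 0 <= t < / 4 -> 0 < X t;
  arc_Y_pos : forall t, 0 < t <= / 4 -> 0 < Y t
}.

(* Since [gamma (t + 1/2) = - gamma t], this is the distance between the points with parameters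
   [a] and [b + 1/2]. *)
Definition chord (X Y : R -> R) (a b : R) : R :=
  sqrt ((X a + X b) ^ 2 + (Y a + Y b) ^ 2).
(** The derivative of [chord] in its first argument: speed times the cosine of the angle between
    chord and tangent. *)
Definition slope (X Y : R -> R) (a b : R) : R :=
  ((X a + X b) * Derive X a + (Y a + Y b) * Derive Y a) / chord X Y a b.

Lemma chord_sym (X Y : R -> R) (a b : R) : chord X Y a b = chord X Y b a.
Proof. unfold chord. f_equal. ring. Qed.

(** The triangle inequality, with the length of the difference vector bounded by the sum of its
    absolute coordinates. After squaring, each cross term is controlled by [Rabs u' <= s] and
    [Rabs v' <= s]. *)
Lemma sqrt_sqr_dist (u v u' v' : R) :
  sqrt (u ^ 2 + v ^ 2) <= sqrt (u' ^ 2 + v' ^ 2) + Rabs (u - u') + Rabs (v - v').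
Proof.
  set (s := sqrt (u' ^ 2 + v' ^ 2)).
  assert (Hs : 0 <= s) by apply sqrt_pos.
  assert (Hs2 : s * s = u' ^ 2 + v' ^ 2) by (apply sqrt_sqrt; nra).
  assert (Hu : Rabs u' <= s) by (apply Rabs_le; split; nra).
  assert (Hv : Rabs v' <= s) by (apply Rabs_le; split; nra).
  pose proof (Rabs_pos (u - u')) as Hp. pose proof (Rabs_pos (v - v')) as Hq.
  rewrite <- (sqrt_pow2 (s + Rabs (u - u') + Rabs (v - v'))) by lra.
  apply sqrt_le_1_alt.
  assert (H : forall x x', Rabs x' <= s -> x ^ 2 <= x' ^ 2 + 2 * s * Rabs (x - x') + Rabs (x - x') ^ 2).
  { intros x x' Hx. rewrite pow2_abs.
    assert (x' * (x - x') <= s * Rabs (x - x')); [|nra].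
    apply Rle_trans with (Rabs (x' * (x - x'))); [apply Rle_abs|].
    rewrite Rabs_mult. apply Rmult_le_compat_r; auto using Rabs_pos. }
  pose proof (H u u' Hu). pose proof (H v v' Hv). nra.
Qed.

(** The right side is free of [b]: this is the uniformity that makes the value functions of the
    maximization continuous. *)
Lemma chord_dist (X Y : R -> R) (a a' b : R) :
  Rabs (chord X Y a b - chord X Y a' b) <= Rabs (X a - X a') + Rabs (Y a - Y a').
Proof.
  unfold chord.
  pose proof (sqrt_sqr_dist (X a + X b) (Y a + Y b) (X a' + X b) (Y a' + Y b)) as H1.
  pose proof (sqrt_sqr_dist (X a' + X b) (Y a' + Y b) (X a + X b) (Y a + Y b)) as H2.
  replace (X a + X b - (X a' + X b)) with (X a - X a') in H1 by ring.
  replace (Y a + Y b - (Y a' + Y b)) with (Y a - Y a') in H1 by ring.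
  replace (X a' + X b - (X a + X b)) with (- (X a - X a')) in H2 by ring.
  replace (Y a' + Y b - (Y a + Y b)) with (- (Y a - Y a')) in H2 by ring.
  rewrite !Rabs_Ropp in H2. apply Rabs_le. lra.
Qed.

Lemma ex_derive_continuity_pt (f : R -> R) (t : R) :
  ex_derive f t -> continuity_pt f t.
Proof.
  intros H. apply continuity_pt_filterlim. exact (ex_derive_continuous f t H).
Qed.

Lemma chord_equicontinuous (X Y : R -> R) (a e : R) :
  continuity_pt X a -> continuity_pt Y a -> 0 < e ->
  exists d, 0 < d /\ forall a' b, Rabs (a' - a) < d ->
    Rabs (chord X Y a' b - chord X Y a b) < e.
Proof.
  intros HX HY He.
  assert (Hc : forall f, continuity_pt f a -> exists d, 0 < d /\
    forall a', Rabs (a' - a) < d -> Rabs (f a' - f a) < e / 2).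
  { intros f Hf. destruct (Hf (e / 2)) as [d [Hd H]]; [lra|].
    exists d. split; [exact Hd|]. intros a' Ha.
    (* [continuity_pt] speaks only of points other than [a]. *)
    destruct (Req_dec a' a) as [->|Hn].
    - rewrite Rminus_diag, Rabs_R0. lra.
    - apply H. split; [split; [exact I|auto]|exact Ha]. }
  destruct (Hc X HX) as [d1 [Hd1 H1]]. destruct (Hc Y HY) as [d2 [Hd2 H2]].
  exists (Rmin d1 d2). split; [apply Rmin_glb_lt; auto|].
  intros a' b Ha.
  pose proof (H1 a' (Rlt_le_trans _ _ _ Ha (Rmin_l _ _))).
  pose proof (H2 a' (Rlt_le_trans _ _ _ Ha (Rmin_r _ _))).
  pose proof (chord_dist X Y a' a b). lra.
Qed.

Lemma chord_continuity (X Y : R -> R) (a b : R) :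
  continuity_pt X b -> continuity_pt Y b -> continuity_pt (chord X Y a) b.
Proof.
  intros HX HY e He.
  destruct (chord_equicontinuous X Y b e HX HY He) as [d [Hd H]].
  exists d. split; [exact Hd|]. intros b' [_ Hb']. simpl in *. unfold R_dist in *.
  rewrite !(chord_sym X Y a). auto.
Qed.

Lemma chord_derive (X Y : R -> R) (a b : R) :
  ex_derive X a -> ex_derive Y a -> 0 < chord X Y a b ->
  is_derive (fun t => chord X Y t b) a (slope X Y a b).
Proof.
  intros HX HY Hp. unfold chord.
  assert (Hq : 0 < (X a + X b) ^ 2 + (Y a + Y b) ^ 2).
  { apply sqrt_lt_0_alt. rewrite sqrt_0. exact Hp. }
  auto_derive.
  - repeat (split; [first [exact HX | exact HY | exact Hq] |]). exact I.
  - unfold slope, chord in *.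
    change (Derive (fun x => X x) a) with (Derive X a).
    change (Derive (fun x => Y x) a) with (Derive Y a).
    replace ((X a + X b) * ((X a + X b) * 1) + (Y a + Y b) * ((Y a + Y b) * 1))
      with ((X a + X b) ^ 2 + (Y a + Y b) ^ 2) by ring.
    field. lra.
Qed.

(** Half the diagonal chord is the distance to the center, the end term for type II. Both arguments
    move and contribute equally, so the factor one half leaves a single slope. *)
Lemma diagonal_derive (X Y : R -> R) (a : R) :
  ex_derive X a -> ex_derive Y a -> 0 < chord X Y a a ->
  is_derive (fun t => chord X Y t t / 2) a (slope X Y a a).
Proof.
  intros HX HY Hp. unfold chord.
  assert (Hq : 0 < (X a + X a) ^ 2 + (Y a + Y a) ^ 2).
  { apply sqrt_lt_0_alt. rewrite sqrt_0. exact Hp. }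
  auto_derive.
  - repeat (split; [first [exact HX | exact HY | exact Hq] |]). exact I.
  - unfold slope, chord in *.
    change (Derive (fun x => X x) a) with (Derive X a).
    change (Derive (fun x => Y x) a) with (Derive Y a).
    replace ((X a + X a) * ((X a + X a) * 1) + (Y a + Y a) * ((Y a + Y a) * 1))
      with ((X a + X a) ^ 2 + (Y a + Y a) ^ 2) by ring.
    field. lra.
Qed.

(** Differentiation of a functional equation; [c = 0] gives the parities of the derivatives, and
    [c = / 2] the tangent on the other axis. *)
Lemma Derive_reflect (f : R -> R) (s c t : R) :
  (forall u, f (c - u) = s * f u) -> ex_derive f (c - t) ->
  Derive f (c - t) = - (s * Derive f t).
Proof.
  intros H Hf.
  assert (H1 : is_derive (fun u => f (c - u)) t (- Derive f (c - t))).
  { auto_derive; [auto|]. change (Derive (fun x => f x)) with (Derive f).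
    unfold Rminus. ring. }
  apply is_derive_unique in H1.
  assert (H2 : Derive (fun u => f (c - u)) t = s * Derive f t).
  { rewrite <- Derive_scal. apply Derive_ext. exact H. }
  pose proof (eq_trans (eq_sym H1) H2). lra.
Qed.

Lemma arc_dX_opp (X Y : R -> R) (t : R) :
  symmetric_arc X Y -> Derive X (- t) = - Derive X t.
Proof.
  intros HA. pose proof (Derive_reflect X 1 0 t) as H.
  rewrite Rminus_0_l in H. rewrite H; [ring| |apply (arc_dX _ _ HA)].
  intros u. rewrite Rminus_0_l, (arc_X_opp _ _ HA). ring.
Qed.

Lemma arc_dY_opp (X Y : R -> R) (t : R) :
  symmetric_arc X Y -> Derive Y (- t) = Derive Y t.
Proof.
  intros HA. pose proof (Derive_reflect Y (-1) 0 t) as H.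
  rewrite Rminus_0_l in H. rewrite H; [ring| |apply (arc_dY _ _ HA)].
  intros u. rewrite Rminus_0_l, (arc_Y_opp _ _ HA). ring.
Qed.

Lemma arc_Y0 (X Y : R -> R) : symmetric_arc X Y -> Y 0 = 0.
Proof. intros HA. pose proof (arc_Y_opp _ _ HA 0) as H. rewrite Ropp_0 in H. lra. Qed.

Lemma arc_dX0 (X Y : R -> R) : symmetric_arc X Y -> Derive X 0 = 0.
Proof. intros HA. pose proof (arc_dX_opp X Y 0 HA) as H. rewrite Ropp_0 in H. lra. Qed.

Lemma arc_X_quarter (X Y : R -> R) : symmetric_arc X Y -> X (/ 4) = 0.
Proof.
  intros HA. pose proof (arc_X_half _ _ HA (- / 4)) as H.
  rewrite (arc_X_opp _ _ HA) in H. replace (- / 4 + / 2) with (/ 4) in H by field. lra.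
Qed.

(** The map [u -> / 2 - u] preserves [Y] and fixes [/ 4]. *)
Lemma arc_dY_quarter (X Y : R -> R) : symmetric_arc X Y -> Derive Y (/ 4) = 0.
Proof.
  intros HA. pose proof (Derive_reflect Y 1 (/ 2) (/ 4)) as H.
  replace (/ 2 - / 4) with (/ 4) in H by field.
  enough (Derive Y (/ 4) = - (1 * Derive Y (/ 4))) by lra.
  apply H; [|apply (arc_dY _ _ HA)].
  intros u. replace (/ 2 - u) with (- u + / 2) by ring.
  rewrite (arc_Y_half _ _ HA), (arc_Y_opp _ _ HA). ring.
Qed.

(** [Y] starts from zero and stays nonnegative, which gives the weak inequality; equality is
    excluded by immersion, since [Derive X] vanishes at [0]. *)
Lemma arc_dY0_pos (X Y : R -> R) : symmetric_arc X Y -> 0 < Derive Y 0.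
Proof.
  intros HA.
  assert (H : - Derive Y 0 <= 0).
  { apply (max_derive_le (fun t => - Y t) 0 (- Derive Y 0) (/ 4)); [lra| |].
    - apply (is_derive_opp (V := R_NormedModule) Y).
      apply Derive_correct. apply (arc_dY _ _ HA).
    - intros s Hs. rewrite (arc_Y0 X Y HA).
      destruct (Req_dec s 0) as [->|Hn]; [rewrite (arc_Y0 X Y HA); lra|].
      pose proof (arc_Y_pos _ _ HA s). lra. }
  destruct (arc_immersed _ _ HA 0) as [H0|H0]; [|lra].
  elim H0. apply (arc_dX0 X Y HA).
Qed.

Lemma arc_dX_quarter_neg (X Y : R -> R) : symmetric_arc X Y -> Derive X (/ 4) < 0.
Proof.
  intros HA.
  assert (H : 0 <= - Derive X (/ 4)).
  { apply (max_derive_ge (fun t => - X t) (/ 4) (- Derive X (/ 4)) 0); [lra| |].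
    - apply (is_derive_opp (V := R_NormedModule) X).
      apply Derive_correct. apply (arc_dX _ _ HA).
    - intros s Hs. rewrite (arc_X_quarter X Y HA).
      destruct (Req_dec s (/ 4)) as [->|Hn]; [rewrite (arc_X_quarter X Y HA); lra|].
      pose proof (arc_X_pos _ _ HA s). lra. }
  destruct (arc_immersed _ _ HA (/ 4)) as [H0|H0]; [lra|].
  elim H0. apply (arc_dY_quarter X Y HA).
Qed.

Lemma arc_nonneg (X Y : R -> R) (t : R) :
  symmetric_arc X Y -> 0 <= t <= / 4 -> 0 <= X t /\ 0 <= Y t /\ 0 < X t + Y t.
Proof.
  intros HA Ht.
  destruct (Req_dec t 0) as [->|H0].
  - rewrite (arc_Y0 X Y HA). pose proof (arc_X_pos _ _ HA 0). lra.
  - pose proof (arc_Y_pos _ _ HA t).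
    destruct (Req_dec t (/ 4)) as [->|H1].
    + rewrite (arc_X_quarter X Y HA). lra.
    + pose proof (arc_X_pos _ _ HA t). lra.
Qed.

Lemma sqrt_sqr_pos (u v : R) : u <> 0 \/ v <> 0 -> 0 < sqrt (u ^ 2 + v ^ 2).
Proof. intros H. apply sqrt_lt_R0. destruct H; nra. Qed.

Lemma chord_pos (X Y : R -> R) (a b : R) :
  symmetric_arc X Y -> 0 <= a <= / 4 -> 0 <= b <= / 4 -> 0 < chord X Y a b.
Proof.
  intros HA Ha Hb. apply sqrt_sqr_pos.
  pose proof (arc_nonneg X Y a HA Ha). pose proof (arc_nonneg X Y b HA Hb).
  destruct (Req_dec (X a + X b) 0); [right|left]; lra.
Qed.

(* The axes are barriers for the maximization: at [0] and at [1/4] the tangent is orthogonal to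
   an axis of symmetry, so no sign of a mixed derivative is needed. *)
Lemma slope_0_nonneg (X Y : R -> R) (b : R) :
  symmetric_arc X Y -> 0 <= b <= / 4 -> 0 <= slope X Y 0 b.
Proof.
  intros HA Hb. unfold slope. rewrite (arc_dX0 X Y HA), (arc_Y0 X Y HA).
  pose proof (chord_pos X Y 0 b HA ltac:(lra) Hb).
  pose proof (arc_dY0_pos X Y HA). pose proof (arc_nonneg X Y b HA Hb).
  apply Rdiv_le_0_compat; nra.
Qed.

(** The equality case of the barrier: by it, contact with the axis spreads from a vertex to its
    neighbors. *)
Lemma slope_0_eq0 (X Y : R -> R) (b : R) :
  symmetric_arc X Y -> 0 <= b <= / 4 -> slope X Y 0 b <= 0 -> b = 0.
Proof.
  intros HA Hb Hs. destruct (Req_dec b 0) as [|Hn]; [auto|exfalso].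
  apply (Rlt_not_le _ _) in Hs; auto.
  unfold slope. rewrite (arc_dX0 X Y HA), (arc_Y0 X Y HA).
  pose proof (chord_pos X Y 0 b HA ltac:(lra) Hb).
  pose proof (arc_dY0_pos X Y HA). pose proof (arc_Y_pos _ _ HA b ltac:(lra)).
  apply Rdiv_lt_0_compat; nra.
Qed.

Lemma slope_quarter (X Y : R -> R) (b : R) :
  symmetric_arc X Y ->
  slope X Y (/ 4) b = - (X b * - Derive X (/ 4) / chord X Y (/ 4) b).
Proof.
  intros HA. unfold slope. rewrite (arc_dY_quarter X Y HA), (arc_X_quarter X Y HA).
  unfold Rdiv. ring.
Qed.

Lemma slope_quarter_nonpos (X Y : R -> R) (b : R) :
  symmetric_arc X Y -> 0 <= b <= / 4 -> slope X Y (/ 4) b <= 0.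
Proof.
  intros HA Hb. rewrite (slope_quarter X Y b HA).
  pose proof (chord_pos X Y (/ 4) b HA ltac:(lra) Hb).
  pose proof (arc_dX_quarter_neg X Y HA). pose proof (arc_nonneg X Y b HA Hb).
  enough (0 <= X b * - Derive X (/ 4) / chord X Y (/ 4) b) by lra.
  apply Rdiv_le_0_compat; nra.
Qed.

Lemma slope_quarter_eq (X Y : R -> R) (b : R) :
  symmetric_arc X Y -> 0 <= b <= / 4 -> 0 <= slope X Y (/ 4) b -> b = / 4.
Proof.
  intros HA Hb Hs. destruct (Req_dec b (/ 4)) as [|Hn]; [auto|exfalso].
  apply (Rlt_not_le _ _) in Hs; auto. rewrite (slope_quarter X Y b HA).
  pose proof (chord_pos X Y (/ 4) b HA ltac:(lra) Hb).
  pose proof (arc_dX_quarter_neg X Y HA). pose proof (arc_X_pos _ _ HA b ltac:(lra)).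
  enough (0 < X b * - Derive X (/ 4) / chord X Y (/ 4) b) by lra.
  apply Rdiv_lt_0_compat; nra.
Qed.

Lemma slope_opp (X Y : R -> R) (a b : R) :
  symmetric_arc X Y -> slope X Y (- a) (- b) = - slope X Y a b.
Proof.
  intros HA. unfold slope, chord.
  rewrite !(arc_X_opp _ _ HA), !(arc_Y_opp _ _ HA), (arc_dX_opp X Y a HA), (arc_dY_opp X Y a HA).
  replace ((- Y a + - Y b) ^ 2) with ((Y a + Y b) ^ 2) by ring.
  unfold Rdiv. ring.
Qed.

(** The chord belonging to [a] and [- a] is parallel to the axis through the point at [0] and has
    length [2 * X a]. Hence the end term [X] pulls on the last vertex exactly as a further vertex at
    the opposite offset would. *)
Lemma slope_antipodal (X Y : R -> R) (a : R) :
  symmetric_arc X Y -> 0 < X a -> slope X Y a (- a) = Derive X a.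
Proof.
  intros HA Ha. unfold slope, chord. rewrite (arc_X_opp _ _ HA), (arc_Y_opp _ _ HA).
  replace ((X a + X a) ^ 2 + (Y a + - Y a) ^ 2) with ((2 * X a) ^ 2) by ring.
  rewrite sqrt_pow2 by lra. field. lra.
Qed.

(** * Interior critical paths *)

Definition upd (f : nat -> R) (i : nat) (t : R) (j : nat) : R :=
  if Nat.eq_dec j i then t else f j.

Lemma upd_eq (f : nat -> R) (i : nat) (t : R) : upd f i t i = t.
Proof. unfold upd. destruct (Nat.eq_dec i i); congruence. Qed.

Lemma upd_neq (f : nat -> R) (i j : nat) (t : R) : j <> i -> upd f i t j = f j.
Proof. intros H. unfold upd. destruct (Nat.eq_dec j i); congruence. Qed.

Lemma path_sum_upd_last (A : R -> R -> R) (f : nat -> R) (n : nat) (t : R) :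
  path_sum A (S n) (upd f (S n) t) = path_sum A n f + A (f n) t.
Proof.
  simpl. rewrite upd_eq, (upd_neq f (S n) n) by lia. f_equal.
  apply path_sum_ext. intros i Hi. apply upd_neq. lia.
Qed.

Lemma path_sum_upd_inner (A : R -> R -> R) (f : nat -> R) (n j : nat) (t : R) :
  (S j < n)%nat ->
  path_sum A n (upd f (S j) t) - path_sum A n f =
  A (f j) t + A t (f (S (S j))) - (A (f j) (f (S j)) + A (f (S j)) (f (S (S j)))).
Proof.
  induction n as [|n IH]; intros H; [lia|].
  destruct (Nat.eq_dec n (S j)) as [->|Hn].
  - change (path_sum A (S (S j)) (upd f (S j) t)) with
      (path_sum A (S j) (upd f (S j) t) + A (upd f (S j) t (S j)) (upd f (S j) t (S (S j)))).
    rewrite path_sum_upd_last, upd_eq, upd_neq by lia. simpl. ring.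
  - simpl. rewrite !(upd_neq f (S j)) by lia.
    pose proof (IH ltac:(lia)). lra.
Qed.

(** A maximizer over the box is taken. A vertex on the boundary of the box would force its neighbors
    onto the same barrier, until the path is zero, which [w] beats, or starts at [/ 4] instead of
    [0]. So every free vertex is interior and critical. *)
Lemma constrained_path (X Y B dB : R -> R) (n : nat) :
  symmetric_arc X Y ->
  (forall t, continuity_pt B t) ->
  (forall t, 0 <= t <= / 4 -> is_derive B t (dB t)) ->
  0 <= dB 0 -> dB (/ 4) <= 0 ->
  (exists w : nat -> R, w O = 0 /\ (forall i, 0 <= w i <= / 4) /\
     path_sum (chord X Y) (S n) (fun _ => 0) + B 0 <
     path_sum (chord X Y) (S n) w + B (w (S n))) ->
  exists f : nat -> R, f O = 0 /\
    (forall i, (1 <= i <= S n)%nat -> 0 < f i < / 4) /\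
    (forall i, (i < n)%nat ->
       slope X Y (f (S i)) (f i) + slope X Y (f (S i)) (f (S (S i))) = 0) /\
    slope X Y (f (S n)) (f n) + dB (f (S n)) = 0.
Proof.
  intros HA HBc HBd HdB0 HdB1 [w [Hw0 [Hw1 Hw2]]].
  pose proof (fun t => ex_derive_continuity_pt X t (arc_dX _ _ HA t)) as HXc.
  pose proof (fun t => ex_derive_continuity_pt Y t (arc_dY _ _ HA t)) as HYc.
  destruct (path_sum_max (chord X Y) 0 (/ 4) ltac:(lra)
     (fun a b => chord_continuity X Y a b (HXc b) (HYc b))
     (fun a e => chord_equicontinuous X Y a e (HXc a) (HYc a))
     (S n) B 0 HBc) as [f [Hf0 [Hf1 Hf2]]].
  assert (Hbox : forall i, (i <= S n)%nat -> 0 <= f i <= / 4).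
  { intros [|i] Hi; [rewrite Hf0; lra|apply Hf1; lia]. }
  assert (Hnz : ~ (forall i, (i <= S n)%nat -> f i = 0)).
  { intros H0. pose proof (Hf2 w Hw0 (fun i _ => Hw1 i)) as H.
    rewrite (path_sum_ext _ _ f (fun _ => 0) H0), (H0 (S n)) in H by lia. lra. }
  (* [C i] is the cost to the right of vertex [S i]: the next chord, or the end term at the last
     vertex. This treats all free vertices alike. *)
  set (C := fun i t => if Nat.eq_dec i n then B t else chord X Y t (f (S (S i)))).
  set (dC := fun i t => if Nat.eq_dec i n then dB t else slope X Y t (f (S (S i)))).
  assert (HCd : forall i t, (i <= n)%nat -> 0 <= t <= / 4 -> is_derive (C i) t (dC i t)).
  { intros i t Hi Ht. unfold C, dC. destruct (Nat.eq_dec i n); [apply HBd; exact Ht|].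
    apply chord_derive; [apply (arc_dX _ _ HA)|apply (arc_dY _ _ HA)|].
    apply (chord_pos X Y t _ HA Ht). apply Hbox. lia. }
  assert (HC0 : forall i, (i <= n)%nat -> 0 <= dC i 0).
  { intros i Hi. unfold dC. destruct (Nat.eq_dec i n); [exact HdB0|].
    apply (slope_0_nonneg X Y _ HA). apply Hbox. lia. }
  assert (HC1 : forall i, (i <= n)%nat -> dC i (/ 4) <= 0).
  { intros i Hi. unfold dC. destruct (Nat.eq_dec i n); [exact HdB1|].
    apply (slope_quarter_nonpos X Y _ HA). apply Hbox. lia. }
  assert (Hopt : forall i t, (i <= n)%nat -> 0 <= t <= / 4 ->
    chord X Y t (f i) + C i t <= chord X Y (f (S i)) (f i) + C i (f (S i))).
  { intros i t Hi Ht.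
    assert (Hu : path_sum (chord X Y) (S n) (upd f (S i) t) + B (upd f (S i) t (S n)) <=
                 path_sum (chord X Y) (S n) f + B (f (S n))).
    { apply Hf2.
      - rewrite upd_neq by lia. exact Hf0.
      - intros j Hj. unfold upd. destruct (Nat.eq_dec j (S i)); auto. }
    unfold C. rewrite !(chord_sym X Y _ (f i)).
    destruct (Nat.eq_dec i n) as [->|Hn].
    - rewrite path_sum_upd_last, upd_eq in Hu. simpl in Hu. lra.
    - rewrite (upd_neq f (S i) (S n)) in Hu by lia.
      pose proof (path_sum_upd_inner (chord X Y) f (S n) i t ltac:(lia)). lra. }
  assert (Hder : forall i, (i <= n)%nat ->
    is_derive (fun t => chord X Y t (f i) + C i t) (f (S i))
      (slope X Y (f (S i)) (f i) + dC i (f (S i)))).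
  { intros i Hi. apply (is_derive_plus (V := R_NormedModule) (fun t => chord X Y t (f i)) (C i)).
    - apply chord_derive; [apply (arc_dX _ _ HA)|apply (arc_dY _ _ HA)|].
      apply (chord_pos X Y _ _ HA); apply Hbox; lia.
    - apply HCd; [exact Hi|apply Hbox; lia]. }
  assert (Hle : forall i, (i <= n)%nat -> f (S i) < / 4 ->
    slope X Y (f (S i)) (f i) + dC i (f (S i)) <= 0).
  { intros i Hi Hlt. apply (max_derive_le _ _ _ (/ 4) Hlt (Hder i Hi)).
    intros s Hs. apply Hopt; [exact Hi|].
    pose proof (Hbox (S i) ltac:(lia)). lra. }
  assert (Hge : forall i, (i <= n)%nat -> 0 < f (S i) ->
    0 <= slope X Y (f (S i)) (f i) + dC i (f (S i))).
  { intros i Hi Hlt. apply (max_derive_ge _ _ _ 0 Hlt (Hder i Hi)).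
    intros s Hs. apply Hopt; [exact Hi|].
    pose proof (Hbox (S i) ltac:(lia)). lra. }
  assert (Hdown : forall i, (i <= n)%nat -> f (S i) = 0 -> f i = 0).
  { intros i Hi H0. pose proof (Hle i Hi ltac:(lra)) as H. rewrite H0 in H.
    pose proof (HC0 i Hi). apply (slope_0_eq0 X Y _ HA); [apply Hbox; lia|lra]. }
  (* Two nonnegative slopes with sum at most zero both vanish. *)
  assert (Hup : forall i, (i < n)%nat -> f (S i) = 0 -> f (S (S i)) = 0).
  { intros i Hi H0. pose proof (Hle i ltac:(lia) ltac:(lra)) as H. rewrite H0 in H.
    pose proof (slope_0_nonneg X Y (f i) HA (Hbox i ltac:(lia))).
    unfold dC in H. destruct (Nat.eq_dec i n); [lia|].
    apply (slope_0_eq0 X Y _ HA); [apply Hbox; lia|lra]. }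
  (* Contact with the upper barrier would spread back to [f 0 = 0]. *)
  assert (Hquarter : forall i, (i <= S n)%nat -> f i <> / 4).
  { induction i as [|i IH]; intros Hi H; [lra|].
    apply IH; [lia|]. pose proof (Hge i ltac:(lia) ltac:(lra)) as H1. rewrite H in H1.
    pose proof (HC1 i ltac:(lia)).
    apply (slope_quarter_eq X Y _ HA); [apply Hbox; lia|lra]. }
  assert (Hpos : forall i, (1 <= i <= S n)%nat -> 0 < f i < / 4).
  { intros i Hi. pose proof (Hbox i ltac:(lia)) as [H1 H2].
    pose proof (Hquarter i ltac:(lia)).
    destruct (Req_dec (f i) 0) as [H0|H0]; [exfalso|lra].
    (* A zero spreads down to vertex [1] and from there up to all vertices. The descent stops at
       [1], because vertex [0] is fixed and satisfies no criticality condition. *)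
    assert (H10 : f 1%nat = 0).
    { destruct i as [|i]; [lia|]. clear H1 H2 H. induction i as [|i IH]; [exact H0|].
      apply IH; [lia|]. apply Hdown; [lia|exact H0]. }
    apply Hnz. intros [|j] Hj; [exact Hf0|].
    induction j as [|j IH]; [exact H10|]. apply Hup; [lia|]. apply IH. lia. }
  assert (Hcrit : forall i, (i <= n)%nat -> slope X Y (f (S i)) (f i) + dC i (f (S i)) = 0).
  { intros i Hi. pose proof (Hpos (S i) ltac:(lia)).
    apply Rle_antisym; [apply Hle|apply Hge]; auto; lra. }
  exists f. split; [exact Hf0|]. split; [exact Hpos|]. split.
  - intros i Hi. pose proof (Hcrit i ltac:(lia)) as H. unfold dC in H.
    destruct (Nat.eq_dec i n); [lia|exact H].
  - pose proof (Hcrit n ltac:(lia)) as H. unfold dC in H.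
    destruct (Nat.eq_dec n n); [exact H|congruence].
Qed.

(* Only the first step and the end term may lose length; every other step of the path [0, e, e,
   e, ...] gains the same positive amount. *)
Lemma constant_path_better (X Y B : R -> R) (e : R) :
  symmetric_arc X Y -> 0 <= e <= / 4 -> chord X Y 0 0 < chord X Y e e ->
  exists n0 : nat, forall n, (n0 <= n)%nat ->
    exists w : nat -> R, w O = 0 /\ (forall i, 0 <= w i <= / 4) /\
      path_sum (chord X Y) (S n) (fun _ => 0) + B 0 <
      path_sum (chord X Y) (S n) w + B (w (S n)).
Proof.
  intros HA He Hlt.
  set (a := chord X Y e e - chord X Y 0 0).
  (* The positive length of the edge from [0] to [e] is dropped, so [b] bounds the loss, against a
     gain of [a] on each of the other [n] edges. *)
  set (b := chord X Y 0 0 + B 0 - B e).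
  destruct (nfloor_ex (Rmax 0 (b / a)) (Rmax_l _ _)) as [k [_ Hk]].
  assert (Ha : 0 < a) by (unfold a; lra).
  exists (S k). intros n Hn.
  exists (fun i => match i with O => 0 | S _ => e end).
  split; [reflexivity|]. split; [intros [|i]; lra|].
  assert (H0 : forall m, path_sum (chord X Y) m (fun _ => 0) = INR m * chord X Y 0 0).
  { induction m as [|m IH]; [simpl; ring|]. rewrite S_INR. simpl path_sum. rewrite IH. ring. }
  assert (H1 : forall m, path_sum (chord X Y) (S m) (fun i => match i with O => 0 | S _ => e end)
    = chord X Y 0 e + INR m * chord X Y e e).
  { induction m as [|m IH]; [simpl; ring|]. rewrite S_INR. 
    change (path_sum (chord X Y) (S (S m)) (fun i => match i with O => 0 | S _ => e end))
      with (path_sum (chord X Y) (S m) (fun i => match i with O => 0 | S _ => e end) + chord X Y e e).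
    rewrite IH. ring. }
  rewrite H0, H1, S_INR.
  pose proof (chord_pos X Y 0 e HA ltac:(lra) He).
  assert (Hb : b < INR n * a).
  { pose proof (Rmax_r 0 (b / a)). apply le_INR in Hn. rewrite S_INR in Hn.
    replace b with (b / a * a) by (field; lra). apply Rmult_lt_compat_r; lra. }
  unfold a, b in Hb. lra.
Qed.

(** * Librations *)

(** The indices from [0] to [P / 2] form a fundamental domain of the group generated by [i -> - i]
    and [i -> i + P]. *)
Lemma odd_periodic_ind (P : Z) (Q : Z -> Prop) :
  (0 < P)%Z -> (forall i, Q i -> Q (- i)%Z) -> (forall i, Q i -> Q (i + P)%Z) ->
  (forall i, (0 <= 2 * i <= P)%Z -> Q i) -> forall i, Q i.
Proof.
  intros HP Hopp Hper Hbase.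
  assert (Hk : forall k i, (0 <= k)%Z -> Q i -> Q (i + P * k)%Z).
  { intros k i Hk. revert k Hk. apply (natlike_ind (fun k => Q i -> Q (i + P * k)%Z)).
    - intros H. replace (i + P * 0)%Z with i by ring. exact H.
    - intros k _ IH H. replace (i + P * Z.succ k)%Z with (i + P * k + P)%Z by (unfold Z.succ; ring).
      auto. }
  assert (Hbase' : forall i, (0 <= i < P)%Z -> Q i).
  { intros i Hi. destruct (Z_le_gt_dec (2 * i) P); [apply Hbase; lia|].
    replace i with (- (P - i) + P)%Z by ring. apply Hper, Hopp, Hbase. lia. }
  intros i. pose proof (Z.mod_pos_bound i P HP) as Hr.
  pose proof (Z.div_mod i P ltac:(lia)) as Hi.
  destruct (Z_le_gt_dec 0 (i / P)) as [Hq|Hq].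
  - rewrite Hi, Z.add_comm. apply Hk; auto.
  (* A downward shift is an upward shift between two sign changes. *)
  - replace i with (- (- (i mod P) + P * (- (i / P))))%Z by lia.
    apply Hopp, Hk; [lia|]. apply Hopp. auto.
Qed.

(** Zeros at [0] and [P / 2], the fixed indices of the reflections, are the only compatibility
    conditions for the extension. *)
Lemma odd_periodic_extension (F : Z -> R) (P : Z) :
  (0 < P)%Z -> F 0%Z = 0 -> (forall i, (2 * i = P)%Z -> F i = 0) ->
  exists y : Z -> R, (forall i, y (- i)%Z = - y i) /\ (forall i, y (i + P)%Z = y i) /\
    forall i, (0 <= 2 * i <= P)%Z -> y i = F i.
Proof.
  intros HP H0 H1.
  exists (fun i => if Z_le_gt_dec (2 * (i mod P)) P then F (i mod P)%Z
                   else - F (P - i mod P)%Z).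
  repeat split.
  - intros i. pose proof (Z.mod_pos_bound i P HP) as Hr.
    destruct (Z.eq_dec (i mod P) 0) as [E|E].
    + rewrite (Z.mod_opp_l_z i P), E by lia.
      destruct (Z_le_gt_dec (2 * 0) P); [rewrite H0; ring|lia].
    + rewrite (Z.mod_opp_l_nz i P) by lia. set (r := (i mod P)%Z) in *.
      destruct (Z_le_gt_dec (2 * (P - r)) P), (Z_le_gt_dec (2 * r) P); try lia.
      * replace (P - r)%Z with r by lia. rewrite (H1 r) by lia. ring.
      * ring.
      * f_equal. f_equal. ring.
  - intros i. replace (i + P)%Z with (i + 1 * P)%Z by ring. rewrite Z.mod_add by lia. reflexivity.
  - intros i Hi. rewrite Z.mod_small by lia.
    destruct (Z_le_gt_dec (2 * i) P); [reflexivity|lia].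
Qed.

(** The derivative of the total chord length in [y i]; its vanishing is the reflection law at vertex
    [i]. *)
Definition balance (X Y : R -> R) (y : Z -> R) (i : Z) : R :=
  slope X Y (y i) (y (i - 1)%Z) + slope X Y (y i) (y (i + 1)%Z).

(** Minimality is stated by divisibility, to be combined with the parity of the index later. The
    last two fields contradict the Birkhoff property. *)
Record libration (X Y : R -> R) (P : Z) (y : Z -> R) : Prop := {
  lib_odd : forall i, y (- i)%Z = - y i;
  lib_periodic : forall i, y (i + P)%Z = y i;
  lib_minimal : forall k, (forall i, y (i + k)%Z = y i) -> (P | k)%Z;
  lib_bound : forall i, - / 4 < y i < / 4;
  lib_balance : forall i, balance X Y y i = 0;
  lib_rises : 0 < y 2%Z;
  lib_falls : exists i, y (i + 2)%Z < y i
}.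

(** Since [balance] inherits oddness and periodicity from [y], half a period determines everything,
    and the balance at [0] and [P / 2] is automatic. *)
Lemma libration_intro (X Y : R -> R) (P : Z) (y : Z -> R) :
  symmetric_arc X Y -> (5 <= P)%Z ->
  (forall i, y (- i)%Z = - y i) -> (forall i, y (i + P)%Z = y i) ->
  (forall i, (0 < 2 * i < P)%Z -> 0 < y i < / 4) ->
  (forall i, (0 < 2 * i < P)%Z -> balance X Y y i = 0) ->
  libration X Y P y.
Proof.
  intros HA HP Hodd Hper Hpos Hbal.
  assert (H0 : y 0%Z = 0) by (pose proof (Hodd 0%Z) as H; simpl in H; lra).
  assert (Hrefl : forall i, y (P - i)%Z = - y i).
  { intros i. rewrite <- Hodd, <- (Hper (- i)%Z). f_equal. ring. }
  assert (Hhalf : forall i, (2 * i = P)%Z -> y i = 0).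
  { intros i Hi. pose proof (Hrefl i) as H. replace (P - i)%Z with i in H by lia. lra. }
  assert (Hnonneg : forall i, (0 <= 2 * i <= P)%Z -> 0 <= y i < / 4).
  { intros i Hi. destruct (Z.eq_dec i 0) as [->|E0]; [lra|].
    destruct (Z.eq_dec (2 * i) P) as [E|E]; [rewrite Hhalf by exact E; lra|].
    pose proof (Hpos i ltac:(lia)). lra. }
  assert (Bodd : forall i, balance X Y y (- i) = - balance X Y y i).
  { intros i. unfold balance.
    replace (- i - 1)%Z with (- (i + 1))%Z by ring.
    replace (- i + 1)%Z with (- (i - 1))%Z by ring.
    rewrite !Hodd, !(slope_opp X Y _ _ HA). ring. }
  assert (Bper : forall i, balance X Y y (i + P) = balance X Y y i).
  { intros i. unfold balance.
    replace (i + P - 1)%Z with (i - 1 + P)%Z by ring.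
    replace (i + P + 1)%Z with (i + 1 + P)%Z by ring.
    rewrite !Hper. reflexivity. }
  constructor; auto.
  - intros k Hk.
    assert (Hr : forall i, y (i + k mod P)%Z = y i).
    { intros i. rewrite <- (Hk i).
      assert (Hm : forall q j, (0 <= q)%Z -> y (j + P * q)%Z = y j).
      { intros q j Hq. revert q Hq. apply natlike_ind.
        - f_equal. ring.
        - intros q _ IH. rewrite <- IH, <- (Hper (j + P * q)%Z). f_equal. unfold Z.succ. ring. }
      pose proof (Z.div_mod k P ltac:(lia)) as E.
      destruct (Z_le_gt_dec 0 (k / P)).
      - rewrite <- (Hm (k / P)%Z (i + k mod P)%Z) by auto. f_equal. lia.
      - rewrite <- (Hm (- (k / P))%Z (i + k)%Z) by lia. f_equal. lia. }
    apply Z.mod_divide; [lia|].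
    pose proof (Z.mod_pos_bound k P ltac:(lia)) as Hb. set (r := (k mod P)%Z) in *.
    destruct (Z.eq_dec r 0) as [|E]; [assumption|exfalso].
    (* [y r = 0] leaves only [r = P / 2], since [y] is positive before and negative after it; but a
       shift by [P / 2] would send the positive [y 1] to a nonpositive value. *)
    pose proof (Hr 0%Z) as Hr0. rewrite Z.add_0_l, H0 in Hr0.
    destruct (Ztrichotomy (2 * r) P) as [H|[H|H]].
    + pose proof (Hpos r ltac:(lia)). lra.
    + pose proof (Hr 1%Z) as Hr1. replace (1 + r)%Z with (P - (r - 1))%Z in Hr1 by lia.
      rewrite Hrefl in Hr1. pose proof (Hnonneg (r - 1)%Z ltac:(lia)).
      pose proof (Hpos 1%Z ltac:(lia)). lra.
    + pose proof (Hrefl r) as H1. pose proof (Hpos (P - r)%Z ltac:(lia)). lra.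
  - apply (odd_periodic_ind P (fun i => - / 4 < y i < / 4)); [lia| | |].
    + intros i Hi. rewrite Hodd. lra.
    + intros i Hi. rewrite Hper. exact Hi.
    + intros i Hi. pose proof (Hnonneg i Hi). lra.
  - apply (odd_periodic_ind P (fun i => balance X Y y i = 0)); [lia| | |].
    + intros i Hi. rewrite Bodd, Hi. ring.
    + intros i Hi. rewrite Bper. exact Hi.
    + intros i Hi. destruct (Z.eq_dec i 0) as [->|E0].
      { pose proof (Bodd 0%Z) as H. simpl in H. lra. }
      destruct (Z.eq_dec (2 * i) P) as [E|E]; [|apply Hbal; lia].
      pose proof (Bodd i) as H. rewrite <- (Bper (- i)%Z) in H.
      replace (- i + P)%Z with i in H by lia. lra.
  (* [5 <= P] places index [2] before the half period. *)
  - apply Hpos. lia.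
  (* [t] is the last index before the half period; two steps later [y] is no longer positive. *)
  - set (t := ((P - 1) / 2)%Z). exists t.
    pose proof (Z.div_mod (P - 1) 2 ltac:(lia)) as Hd.
    pose proof (Z.mod_pos_bound (P - 1) 2 ltac:(lia)) as Hm.
    fold t in Hd.
    pose proof (Hpos t ltac:(lia)).
    replace (t + 2)%Z with (P - (P - t - 2))%Z by ring. rewrite Hrefl.
    pose proof (Hnonneg (P - t - 2)%Z ltac:(lia)). lra.
Qed.

(** With odd period [2 (n + 1) + 1], oddness forces the value [- f (n + 1)] at index [n + 2], so the
    end condition is the balance at [n + 1]. *)
Lemma antipodal_libration (X Y : R -> R) (n : nat) (f : nat -> R) :
  symmetric_arc X Y -> (1 <= n)%nat -> f O = 0 ->
  (forall i, (1 <= i <= S n)%nat -> 0 < f i < / 4) ->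
  (forall i, (i < n)%nat ->
     slope X Y (f (S i)) (f i) + slope X Y (f (S i)) (f (S (S i))) = 0) ->
  slope X Y (f (S n)) (f n) + slope X Y (f (S n)) (- f (S n)) = 0 ->
  exists y, libration X Y (2 * Z.of_nat (S n) + 1) y.
Proof.
  intros HA Hn Hf0 Hpos Hcrit Hend. set (P := (2 * Z.of_nat (S n) + 1)%Z).
  destruct (odd_periodic_extension (fun i => f (Z.to_nat i)) P) as [y [Hodd [Hper Hy]]];
    [unfold P; lia|exact Hf0|unfold P; lia|].
  assert (Hyn : forall i, (i <= S n)%nat -> y (Z.of_nat i) = f i).
  { intros i Hi. rewrite Hy by (unfold P; lia). now rewrite Nat2Z.id. }
  exists y. apply (libration_intro X Y P y HA); auto.
  - unfold P; lia.
  - intros i Hi. rewrite Hy by lia. apply Hpos. unfold P in Hi. lia.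
  - intros i Hi. unfold balance, P in *.
    destruct (Z_of_nat_complete (i - 1) ltac:(lia)) as [j Hj].
    replace i with (Z.of_nat (S j)) by lia.
    replace (Z.of_nat (S j) - 1)%Z with (Z.of_nat j) by lia.
    rewrite !Hyn by lia.
    destruct (Nat.eq_dec j n) as [->|E].
    + replace (y (Z.of_nat (S n) + 1)%Z) with (- f (S n)); [exact Hend|].
      rewrite <- (Hyn (S n)), <- Hodd, <- Hper by lia. f_equal. lia.
    + replace (Z.of_nat (S j) + 1)%Z with (Z.of_nat (S (S j))) by lia.
      rewrite Hyn by lia. apply Hcrit. lia.
Qed.

(* With [h = 2 (n + 1)] the quarter oscillation [f 0, ..., f (n + 1)] is reflected at its last
   vertex, with [h = 2 (n + 1) + 1] at the midpoint of its last edge. *)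
Lemma reflected_libration (X Y : R -> R) (n : nat) (h : Z) (f : nat -> R) :
  symmetric_arc X Y -> (1 <= n)%nat ->
  (2 * Z.of_nat (S n) <= h <= 2 * Z.of_nat (S n) + 1)%Z -> f O = 0 ->
  (forall i, (1 <= i <= S n)%nat -> 0 < f i < / 4) ->
  (forall i, (i < n)%nat ->
     slope X Y (f (S i)) (f i) + slope X Y (f (S i)) (f (S (S i))) = 0) ->
  slope X Y (f (S n)) (f n) +
    slope X Y (f (S n)) (f (Z.to_nat (h - Z.of_nat (S (S n))))) = 0 ->
  exists y, libration X Y (2 * h) y /\ forall i, y (h - i)%Z = y i.
Proof.
  intros HA Hn Hh Hf0 Hpos Hcrit Hend.
  set (F := fun i => if Z_le_gt_dec i (Z.of_nat (S n)) then f (Z.to_nat i)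
                     else f (Z.to_nat (h - i))).
  destruct (odd_periodic_extension F (2 * h)) as [y [Hodd [Hper Hy]]].
  - lia.
  - unfold F. destruct (Z_le_gt_dec 0 (Z.of_nat (S n))); [exact Hf0|lia].
  - intros i Hi. unfold F. replace i with h by lia.
    destruct (Z_le_gt_dec h (Z.of_nat (S n))); [lia|]. now rewrite Z.sub_diag.
  - assert (Hyn : forall i, (i <= S n)%nat -> y (Z.of_nat i) = f i).
    { intros i Hi. rewrite Hy by lia. unfold F.
      destruct (Z_le_gt_dec (Z.of_nat i) (Z.of_nat (S n))); [|lia]. now rewrite Nat2Z.id. }
    assert (Hrefl : forall i, y (h - i)%Z = y i).
    { apply (odd_periodic_ind (2 * h) (fun i => y (h - i)%Z = y i)); [lia| | |].
      - intros i Hi. rewrite Hodd, <- Hi, <- Hodd, <- (Hper (- (h - i))%Z). f_equal. ring.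
      - intros i Hi. rewrite Hper, <- Hi, <- (Hper (h - (i + 2 * h))%Z). f_equal. ring.
      - intros i Hi. rewrite !Hy by lia. unfold F.
        destruct (Z_le_gt_dec (h - i) (Z.of_nat (S n))), (Z_le_gt_dec i (Z.of_nat (S n)));
          try lia; f_equal; f_equal; lia. }
    exists y. split; [|exact Hrefl].
    assert (Hlow : forall i, (0 < i <= Z.of_nat (S n))%Z -> balance X Y y i = 0).
    { intros i Hi. unfold balance.
      destruct (Z_of_nat_complete (i - 1) ltac:(lia)) as [j Hj].
      replace i with (Z.of_nat (S j)) by lia.
      replace (Z.of_nat (S j) - 1)%Z with (Z.of_nat j) by lia.
      rewrite !Hyn by lia.
      destruct (Nat.eq_dec j n) as [->|E].
      (* The successor [n + 2] of the last given vertex is the mirror image of [h - (n + 2)], which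
         is [n] or [n + 1]. *)
      - rewrite <- (Hyn (Z.to_nat (h - Z.of_nat (S (S n))))) in Hend by lia.
        rewrite Z2Nat.id, Hrefl in Hend by lia.
        replace (Z.of_nat (S n) + 1)%Z with (Z.of_nat (S (S n))) by lia. exact Hend.
      - replace (Z.of_nat (S j) + 1)%Z with (Z.of_nat (S (S j))) by lia.
        rewrite Hyn by lia. apply Hcrit. lia. }
    assert (Brefl : forall i, balance X Y y (h - i) = balance X Y y i).
    { intros i. unfold balance.
      replace (h - i - 1)%Z with (h - (i + 1))%Z by ring.
      replace (h - i + 1)%Z with (h - (i - 1))%Z by ring.
      rewrite !Hrefl. ring. }
    apply (libration_intro X Y (2 * h) y HA); auto.
    + lia.
    + intros i Hi. destruct (Z_le_gt_dec i (Z.of_nat (S n))) as [H|H].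
      * replace i with (Z.of_nat (Z.to_nat i)) by lia. rewrite Hyn by lia. apply Hpos. lia.
      * rewrite <- Hrefl. replace (h - i)%Z with (Z.of_nat (Z.to_nat (h - i))) by lia.
        rewrite Hyn by lia. apply Hpos. lia.
    + intros i Hi. destruct (Z_le_gt_dec i (Z.of_nat (S n))) as [H|H].
      * apply Hlow. lia.
      * rewrite <- Brefl. apply Hlow. lia.
Qed.

(* For [TypeI] the period of [y] is odd, and the billiard orbit, in which consecutive points
   are on opposite sides, has twice that period. *)
Definition typed_libration (T : orbit_type) (X Y : R -> R) (m : Z) (y : Z -> R) : Prop :=
  match T with
  | TypeI => libration X Y (2 * m + 1) y
  | TypeII => libration X Y (2 * (2 * m + 1)) y /\ forall i, y (2 * m + 1 - i)%Z = y i
  | TypeV => libration X Y (2 * (2 * m)) y /\ forall i, y (2 * m - i)%Z = y i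
  end.

(** Each end term replaces the missing edge at the last vertex: [X] an edge to the opposite offset,
    the distance to the center an edge to an equal offset. With no end term the last slope vanishes
    and may be counted twice, as at a turning vertex. *)
Lemma long_librations (X Y : R -> R) (e : R) (T : orbit_type) :
  symmetric_arc X Y -> 0 <= e <= / 4 -> chord X Y 0 0 < chord X Y e e ->
  exists m0 : Z, forall m, (m0 <= m)%Z -> exists y, typed_libration T X Y m y.
Proof.
  intros HA He Hlt.
  set (B := match T with
            | TypeI => X
            | TypeII => fun t => chord X Y t t / 2
            | TypeV => fun _ => 0
            end).
  set (dB := match T with
             | TypeI => Derive X
             | TypeII => fun t => slope X Y t t
             | TypeV => fun _ => 0
             end).
  destruct (constant_path_better X Y B e HA He Hlt) as [n0 Hn0].
  pose proof (fun t => ex_derive_continuity_pt X t (arc_dX _ _ HA t)) as HXc.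
  pose proof (fun t => ex_derive_continuity_pt Y t (arc_dY _ _ HA t)) as HYc.
  assert (HBc : forall t, continuity_pt B t).
  { intros t. unfold B. destruct T; [apply HXc| |apply continuity_pt_const; intros ? ?; reflexivity].
    unfold chord. apply continuity_pt_filterlim.
    apply (continuous_mult (K := R_AbsRing) (fun t => sqrt ((X t + X t) ^ 2 + (Y t + Y t) ^ 2)));
      [|apply continuous_const].
    apply continuity_pt_filterlim. apply continuity_pt_comp with (f2 := sqrt).
    - apply continuity_pt_plus; apply (continuity_pt_comp (fun t => _ + _) (fun s => s ^ 2));
        try apply continuity_pt_plus; auto; apply derivable_continuous_pt, derivable_pt_pow.
    - apply continuity_pt_sqrt. nra. }
  assert (HBd : forall t, 0 <= t <= / 4 -> is_derive B t (dB t)).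
  { intros t Ht. unfold B, dB. destruct T.
    - apply Derive_correct, (arc_dX _ _ HA).
    - apply diagonal_derive; [apply (arc_dX _ _ HA)|apply (arc_dY _ _ HA)|].
      apply (chord_pos X Y t t HA Ht Ht).
    - apply (is_derive_const (K := R_AbsRing) (V := R_NormedModule)). }
  assert (HdB0 : 0 <= dB 0).
  { unfold dB. destruct T; [rewrite (arc_dX0 X Y HA); lra| |lra].
    apply (slope_0_nonneg X Y 0 HA). lra. }
  assert (HdB1 : dB (/ 4) <= 0).
  { unfold dB. destruct T; [pose proof (arc_dX_quarter_neg X Y HA); lra| |lra].
    apply (slope_quarter_nonpos X Y (/ 4) HA). lra. }
  (* Then [n = m - 1] is at least [n0] and at least [1]. *)
  exists (Z.of_nat n0 + 2)%Z. intros m Hm.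
  destruct (Z_of_nat_complete (m - 1) ltac:(lia)) as [n Hn].
  replace m with (Z.of_nat (S n)) by lia.
  destruct (constrained_path X Y B dB n HA HBc HBd HdB0 HdB1 (Hn0 n ltac:(lia)))
    as [f [Hf0 [Hpos [Hcrit Hend]]]].
  unfold B, dB in *. destruct T.
  - apply (antipodal_libration X Y n f HA); auto; [lia|].
    rewrite slope_antipodal; auto.
    apply (arc_X_pos _ _ HA). pose proof (Hpos (S n) ltac:(lia)). lra.
  - apply (reflected_libration X Y n _ f HA); auto; [lia|lia|].
    replace (Z.to_nat _) with (S n) by lia. exact Hend.
  - apply (reflected_libration X Y n _ f HA); auto; [lia|lia|].
    replace (Z.to_nat _) with n by lia. lra.
Qed.

(** * From librations to billiard orbits *)

Definition parity_sign (i : Z) : R := if Z.even i then 1 else -1.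

Lemma parity_sign_succ (i : Z) : parity_sign (i + 1) = - parity_sign i.
Proof.
  unfold parity_sign. rewrite Z.add_1_r, Z.even_succ, <- Z.negb_even.
  destruct (Z.even i); simpl; ring.
Qed.

Lemma parity_sign_sqr (i : Z) : parity_sign i * parity_sign i = 1.
Proof. unfold parity_sign. destruct (Z.even i); ring. Qed.

Lemma half_turns (f : R -> R) :
  (forall t, f (t + / 2) = - f t) ->
  forall i t, f (IZR i / 2 + t) = parity_sign i * f t.
Proof.
  intros H i. induction i as [|i IH|i IH] using Z.peano_ind; intros t.
  - replace (0 / 2 + t) with t by field. unfold parity_sign. simpl. ring.
  - unfold Z.succ. rewrite parity_sign_succ, plus_IZR.
    replace ((IZR i + 1) / 2 + t) with (IZR i / 2 + t + / 2) by field.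
    rewrite H, IH. ring.
  - pose proof (parity_sign_succ (Z.pred i)) as Hp.
    replace (Z.pred i + 1)%Z with i in Hp by (unfold Z.pred; ring).
    pose proof (H (IZR (Z.pred i) / 2 + t)) as H1.
    replace (IZR (Z.pred i) / 2 + t + / 2) with (IZR i / 2 + t) in H1
      by (unfold Z.pred; rewrite plus_IZR; field).
    rewrite IH, Hp in H1. lra.
Qed.

Lemma Derive_shift (f : R -> R) (c t : R) :
  Derive (fun u => f (u + c)) t = Derive f (t + c).
Proof.
  unfold Derive. f_equal. apply Lim_ext. intros s.
  now replace (t + s + c) with (t + c + s) by ring.
Qed.

(* [s] is the reflection that fixes [h 0]. *)
Record symmetric_param (s : D2) (h : R -> pt) : Prop := {
  param_axis : s = D2S \/ s = D2RS;
  param_opp : forall t, h (- t) = act s (h t);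
  param_half : forall t, h (t + / 2) = Rot (h t);
  param_inj : forall u t, h u = h t -> exists k, u = t + IZR k
}.

Lemma param_half_turns (s : D2) (h : R -> pt) (i : Z) (t : R) :
  symmetric_param s h -> h (IZR i / 2 + t) = pscal (parity_sign i) (h t).
Proof.
  intros Hh. apply injective_projections.
  - apply (half_turns (cx h)). intros u. unfold cx. now rewrite (param_half _ _ Hh).
  - apply (half_turns (cy h)). intros u. unfold cy. now rewrite (param_half _ _ Hh).
Qed.

Lemma tangent_half_turns (s : D2) (h : R -> pt) (i : Z) (t : R) :
  symmetric_param s h -> tangent h (IZR i / 2 + t) = pscal (parity_sign i) (tangent h t).
Proof.
  intros Hh.
  assert (H : forall f, (forall u, f (u + / 2) = - f u) ->
    forall u, Derive f (u + / 2) = - Derive f u).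
  { intros f Hf u. rewrite <- Derive_shift, <- Derive_opp. apply Derive_ext. exact Hf. }
  apply injective_projections.
  - apply (half_turns (Derive (cx h))). apply H. intros u. unfold cx.
    now rewrite (param_half _ _ Hh).
  - apply (half_turns (Derive (cy h))). apply H. intros u. unfold cy.
    now rewrite (param_half _ _ Hh).
Qed.

(** Injectivity modulo [1] makes [a - b - 2 k = 2 (v - u)] for an integer [k], and the right side
    lies strictly between [-1] and [1]. Periods and symmetries of orbits thus reduce to parities and
    equalities of offsets. *)
Lemma param_eq_iff (s : D2) (h : R -> pt) (a b : Z) (u v : R) :
  symmetric_param s h -> - / 4 < u < / 4 -> - / 4 < v < / 4 ->
  h (IZR a / 2 + u) = h (IZR b / 2 + v) <-> (Z.Even (a - b) /\ u = v).
Proof.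
  intros Hh Hu Hv. split.
  - intros H. destruct (param_inj _ _ Hh _ _ H) as [k Hk].
    assert (E : IZR (a - b - 2 * k) = 2 * (v - u)).
    { rewrite !minus_IZR, mult_IZR. lra. }
    assert (E0 : (a - b - 2 * k = 0)%Z).
    { assert (- 1 < a - b - 2 * k < 1)%Z; [|lia]. split; apply lt_IZR; lra. }
    rewrite E0 in E. split; [exists k; lia|lra].
  - intros [[k Hk] ->]. rewrite !(param_half_turns s h _ _ Hh).
    replace a with (b + 2 * k)%Z by lia. unfold parity_sign.
    rewrite Z.even_add_mul_2. reflexivity.
Qed.

Definition points (h : R -> pt) (y : Z -> R) (i : Z) : pt := h (IZR i / 2 + y i).

(** The form of [slope] that is independent of the order and the signs of the coordinates. *)
Definition physical_slope (h : R -> pt) (a b : R) : R :=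
  dot (padd (h a) (h b)) (tangent h a) / pnorm (padd (h a) (h b)).

Lemma pnorm_sign (i : Z) (p : pt) : pnorm (pscal (parity_sign i) p) = pnorm p.
Proof.
  unfold pnorm, dot, pscal. simpl. f_equal.
  transitivity (parity_sign i * parity_sign i * (fst p * fst p + snd p * snd p)); [ring|].
  rewrite parity_sign_sqr. ring.
Qed.

Lemma points_step (s : D2) (h : R -> pt) (y : Z -> R) (i : Z) :
  symmetric_param s h ->
  psub (points h y (i + 1)) (points h y i) =
  pscal (parity_sign (i + 1)) (padd (h (y i)) (h (y (i + 1)%Z))).
Proof.
  intros Hh. unfold points. rewrite !(param_half_turns s h _ _ Hh).
  rewrite parity_sign_succ. unfold psub, pscal, padd. simpl. f_equal; ring.
Qed.

(** By the half turns between consecutive indices, the incoming and outgoing directions are sums of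
    two curve points with opposite signs. Equal tangential components therefore mean that the two
    slopes cancel. *)
Lemma reflection_law (s : D2) (h : R -> pt) (y : Z -> R) (i : Z) (t : R) :
  symmetric_param s h ->
  physical_slope h (y i) (y (i - 1)%Z) + physical_slope h (y i) (y (i + 1)%Z) = 0 ->
  h t = points h y i ->
  dot (unit_dir (points h y) (i - 1)) (tangent h t) =
  dot (unit_dir (points h y) i) (tangent h t).
Proof.
  intros Hh Hb Ht. destruct (param_inj _ _ Hh _ _ Ht) as [k Hk].
  replace t with (IZR (i + 2 * k) / 2 + y i)
    by (rewrite Hk, plus_IZR, mult_IZR; field).
  rewrite (tangent_half_turns s h _ _ Hh).
  replace (parity_sign (i + 2 * k)) with (parity_sign i)
    by (unfold parity_sign; now rewrite Z.even_add_mul_2).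
  assert (E : forall j, unit_dir (points h y) j =
    pscal (/ pnorm (padd (h (y j)) (h (y (j + 1)%Z))))
      (pscal (parity_sign (j + 1)) (padd (h (y j)) (h (y (j + 1)%Z))))).
  { intros j. unfold unit_dir, pdist. rewrite !(points_step s h y j Hh), pnorm_sign.
    reflexivity. }
  rewrite !E. replace (i - 1 + 1)%Z with i by ring. rewrite parity_sign_succ.
  replace (padd (h (y (i - 1)%Z)) (h (y i))) with (padd (h (y i)) (h (y (i - 1)%Z)))
    by (unfold padd; f_equal; ring).
  unfold physical_slope in Hb.
  transitivity (parity_sign i * parity_sign i *
    (dot (padd (h (y i)) (h (y (i - 1)%Z))) (tangent h (y i)) /
     pnorm (padd (h (y i)) (h (y (i - 1)%Z))))).
  { unfold dot, pscal. simpl. unfold Rdiv. ring. }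
  transitivity (parity_sign i * parity_sign i *
    - (dot (padd (h (y i)) (h (y (i + 1)%Z))) (tangent h (y i)) /
     pnorm (padd (h (y i)) (h (y (i + 1)%Z))))).
  2:{ unfold dot, pscal. simpl. unfold Rdiv. ring. }
  f_equal. lra.
Qed.

Definition period (T : orbit_type) (m : Z) : Z :=
  match T with
  | TypeI => 2 * (2 * m + 1)
  | TypeII => 2 * (2 * m + 1)
  | TypeV => 2 * (2 * m)
  end.

Lemma typed_libration_libration (T : orbit_type) (X Y : R -> R) (m : Z) (y : Z -> R) :
  typed_libration T X Y m y -> exists P, libration X Y P y.
Proof. destruct T; simpl; intros H; eexists; apply H. Qed.

Lemma Rot_Rot (p : pt) : Rot (Rot p) = p.
Proof. destruct p. unfold Rot. simpl. f_equal; ring. Qed.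

(* The lift of [points h y] is [i / 2 + y i], and by [0 < y 2] order-preservation would make
   [y] nondecreasing along steps of length two. *)
Lemma libration_not_birkhoff (s : D2) (h : R -> pt) (X Y : R -> R) (P : Z) (y : Z -> R) :
  symmetric_param s h -> libration X Y P y -> ~ birkhoff_orbit h (points h y).
Proof.
  intros Hh Hy [x [Hx Hb]].
  assert (Hk : forall i, exists k, x i = IZR i / 2 + y i + IZR k)
    by (intros i; exact (param_inj _ _ Hh _ _ (proj1 (Hx i)))).
  destruct (Hk 0%Z) as [k0 Hk0].
  (* The integer ambiguity of a lift cannot jump, since each step of both lifts lies strictly
     between [0] and [1]. *)
  assert (Hstep : forall i k, x i = IZR i / 2 + y i + IZR k <->
    x (i + 1)%Z = IZR (i + 1) / 2 + y (i + 1)%Z + IZR k).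
  { intros i k. destruct (Hk i) as [k1 H1]. destruct (Hk (i + 1)%Z) as [k2 H2].
    pose proof (proj2 (Hx i)) as H. rewrite H1, H2, plus_IZR in H.
    pose proof (lib_bound _ _ _ _ Hy i). pose proof (lib_bound _ _ _ _ Hy (i + 1)%Z).
    assert (E : k2 = k1).
    { assert (- 1 < k2 - k1 < 1)%Z; [|lia]. split; apply lt_IZR; rewrite minus_IZR; lra. }
    subst k2. rewrite H1, H2. split; intros; lra. }
  assert (Hall : forall i, x i = IZR i / 2 + y i + IZR k0).
  { intros i. induction i as [|i IH|i IH] using Z.peano_ind; [exact Hk0| |].
    - apply (Hstep i). exact IH.
    - apply (Hstep (Z.pred i)). replace (Z.pred i + 1)%Z with i by (unfold Z.pred; ring).
      exact IH. }
  destruct (lib_falls _ _ _ _ Hy) as [i Hi].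
  pose proof (lib_rises _ _ _ _ Hy) as H2.
  pose proof (lib_odd _ _ _ _ Hy 0%Z) as H0. simpl in H0.
  (* As [y 0 = 0 < y 2], the comparison of [x 0] with [x 2 - 1] holds; translated by [i] it reads
     [y i <= y (i + 2)]. *)
  pose proof (Hb 0%Z 2%Z i (-1)%Z) as H.
  rewrite !Hall, Z.add_0_l, (Z.add_comm 2 i), plus_IZR in H.
  pose proof (H ltac:(lra)). lra.
Qed.

Lemma libration_lift (h : R -> pt) (X Y : R -> R) (P : Z) (y : Z -> R) :
  libration X Y P y -> is_lift h (points h y) (fun i => IZR i / 2 + y i).
Proof.
  intros Hy i. split; [reflexivity|]. rewrite plus_IZR.
  pose proof (lib_bound _ _ _ _ Hy i). pose proof (lib_bound _ _ _ _ Hy (i + 1)%Z). lra.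
Qed.

Lemma libration_rotation (h : R -> pt) (X Y : R -> R) (P : Z) (y : Z -> R) :
  libration X Y P y -> rotation_number h (points h y) (/ 2).
Proof.
  intros Hy. exists (fun i => IZR i / 2 + y i).
  split; [exact (libration_lift h X Y P y Hy)|].
  intros e He. destruct (nfloor_ex (/ e)) as [N [_ HN]].
  { left. apply Rinv_0_lt_compat, He. }
  exists (S N). intros n Hn. apply le_INR in Hn. rewrite S_INR in Hn.
  pose proof (pos_INR N) as HN0. unfold R_dist. rewrite <- INR_IZR_INZ.
  pose proof (lib_bound _ _ _ _ Hy (Z.of_nat n)). pose proof (lib_bound _ _ _ _ Hy 0%Z).
  replace ((INR n / 2 + y (Z.of_nat n) - (0 / 2 + y 0%Z)) / INR n - / 2)
    with ((y (Z.of_nat n) - y 0%Z) * / INR n) by (field; lra).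
  assert (Hinv : / INR n < e).
  { rewrite <- (Rinv_inv e). apply Rinv_lt_contravar; [|lra].
    apply Rmult_lt_0_compat; [apply Rinv_0_lt_compat, He|lra]. }
  pose proof (Rinv_0_lt_compat (INR n) ltac:(lra)).
  rewrite Rabs_mult, (Rabs_pos_eq (/ INR n)) by lra.
  apply Rle_lt_trans with (1 * / INR n); [|lra].
  apply Rmult_le_compat_r; [lra|]. apply Rabs_le. lra.
Qed.

Lemma libration_billiard (s : D2) (h : R -> pt) (X Y : R -> R) (P : Z) (y : Z -> R) :
  symmetric_param s h -> (forall a b, slope X Y a b = physical_slope h a b) ->
  libration X Y P y -> billiard_orbit h (points h y).
Proof.
  intros Hh HXY Hy. split; [|split].
  - intros i. eexists. reflexivity.
  - intros i H. apply (param_eq_iff s h _ _ _ _ Hh) in H; try apply (lib_bound _ _ _ _ Hy).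
    destruct H as [[k Hk] _]. lia.
  - intros i t Ht. apply (reflection_law s h y i t Hh); [|exact Ht].
    rewrite <- !HXY. apply (lib_balance _ _ _ _ Hy).
Qed.


(** * Symmetry types and minimal periods *)

Lemma points_rotated (s : D2) (h : R -> pt) (y : Z -> R) (i j : Z) :
  symmetric_param s h -> (forall i, - / 4 < y i < / 4) ->
  Rot (points h y i) = points h y j <-> Z.Even (i + 1 - j) /\ y i = y j.
Proof.
  intros Hh Hy. unfold points. rewrite <- (param_half _ _ Hh).
  replace (IZR i / 2 + y i + / 2) with (IZR (i + 1) / 2 + y i) by (rewrite plus_IZR; field).
  apply (param_eq_iff s h _ _ _ _ Hh); auto.
Qed.

Lemma points_reflected (s : D2) (h : R -> pt) (y : Z -> R) (i j : Z) :
  symmetric_param s h -> (forall i, - / 4 < y i < / 4) ->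
  act s (points h y i) = points h y j <-> Z.Even (- i - j) /\ - y i = y j.
Proof.
  intros Hh Hy. unfold points. rewrite <- (param_opp _ _ Hh).
  replace (- (IZR i / 2 + y i)) with (IZR (- i) / 2 + - y i) by (rewrite opp_IZR; field).
  apply (param_eq_iff s h _ _ _ _ Hh); auto. pose proof (Hy i). lra.
Qed.

Lemma points_rotated_reflected (s : D2) (h : R -> pt) (y : Z -> R) (i j : Z) :
  symmetric_param s h -> (forall i, - / 4 < y i < / 4) ->
  Rot (act s (points h y i)) = points h y j <-> Z.Even (1 - i - j) /\ - y i = y j.
Proof.
  intros Hh Hy. unfold points. rewrite <- (param_opp _ _ Hh), <- (param_half _ _ Hh).
  replace (- (IZR i / 2 + y i) + / 2) with (IZR (1 - i) / 2 + - y i)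
    by (rewrite minus_IZR; field).
  apply (param_eq_iff s h _ _ _ _ Hh); auto. pose proof (Hy i). lra.
Qed.

Lemma points_shifted (s : D2) (h : R -> pt) (y : Z -> R) (i j : Z) :
  symmetric_param s h -> (forall i, - / 4 < y i < / 4) ->
  points h y i = points h y j <-> Z.Even (i - j) /\ y i = y j.
Proof. intros Hh Hy. apply (param_eq_iff s h _ _ _ _ Hh); auto. Qed.

Lemma reflections (s r : D2) :
  (s = D2S \/ s = D2RS) -> (r = D2S \/ r = D2RS) ->
  (forall p, act r p = act s p) \/ (forall p, act r p = Rot (act s p)).
Proof.
  intros [->| ->] [->| ->]; auto; right; intros p; simpl; auto. now rewrite Rot_Rot.
Qed.

Lemma D2_symmetric_orbit_intro (s : D2) (z : Z -> pt) (k : Z) :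
  (s = D2S \/ s = D2RS) -> Hsym z D2R ->
  (forall i, act s (z i) = z (k - i)%Z) ->
  ((exists l, forall i, Rot (act s (z i)) = z (l + i)%Z) \/
   (exists l, forall i, Rot (act s (z i)) = z (l - i)%Z)) ->
  D2_symmetric_orbit z.
Proof.
  intros Hs HR Hk HRs.
  assert (Hr : forall r, (r = D2S \/ r = D2RS) -> Hsym z r).
  { intros r Hr. destruct (reflections s r Hs Hr) as [E|E].
    - right. exists k. intros i. rewrite E. apply Hk.
    - destruct HRs as [[l H]|[l H]]; [left|right]; exists l; intros i; rewrite E; apply H. }
  intros [| | |]; auto. left. exists 0%Z. reflexivity.
Qed.

(** The periods of the points are the even periods of [y], so the minimal one is the least common
    multiple of [2] and the period of [y]. *)
Lemma typed_libration_period (s : D2) (h : R -> pt) (T : orbit_type) (X Y : R -> R)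
    (m : Z) (y : Z -> R) :
  symmetric_param s h -> (0 < m)%Z -> typed_libration T X Y m y ->
  periodic_min (points h y) (period T m).
Proof.
  intros Hh Hm Hy.
  assert (HP : forall P, libration X Y P y ->
    (forall k, (forall i, points h y (i + k) = points h y i) -> Z.Even k /\ (P | k)%Z) /\
    (Z.Even P -> forall i, points h y (i + P) = points h y i) /\
    (forall i, points h y (i + 2 * P) = points h y i)).
  { intros P HP. pose proof (lib_bound _ _ _ _ HP) as Hb. split; [|split].
    - intros k Hk. split.
      + pose proof (proj1 (points_shifted s h y _ _ Hh Hb) (Hk 0%Z)) as [H _].
        now rewrite Z.sub_0_r in H.
      + apply (lib_minimal _ _ _ _ HP). intros i.
        now apply (points_shifted s h y _ _ Hh Hb).
    - intros HE i. apply (points_shifted s h y _ _ Hh Hb).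
      replace (i + P - i)%Z with P by ring. split; [exact HE|apply (lib_periodic _ _ _ _ HP)].
    - intros i. apply (points_shifted s h y _ _ Hh Hb). split; [exists P; ring|].
      replace (i + 2 * P)%Z with (i + P + P)%Z by ring.
      now rewrite !(lib_periodic _ _ _ _ HP). }
  destruct T; cbv [period typed_libration has_type] in *.
  - destruct (HP _ Hy) as [H1 [_ H2]]. split; [lia|]. split; [exact H2|].
    intros q Hq H. destruct (H1 q H) as [[a Ha] [b Hb]].
    assert (b = 1)%Z by nia. lia.
  - destruct Hy as [Hy _]. destruct (HP _ Hy) as [H1 [H2 _]].
    split; [lia|]. split; [apply H2; eexists; reflexivity|].
    intros q Hq H. destruct (H1 q H) as [_ Hd]. apply Z.divide_pos_le in Hd; lia.
  - destruct Hy as [Hy _]. destruct (HP _ Hy) as [H1 [H2 _]].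
    split; [lia|]. split; [apply H2; eexists; reflexivity|].
    intros q Hq H. destruct (H1 q H) as [_ Hd]. apply Z.divide_pos_le in Hd; lia.
Qed.

(** The composite of the reflections [i -> - i] and [i -> l - i] is the shift by [l]. *)
Lemma antiperiodic_of_reflected (X Y : R -> R) (l : Z) (y : Z -> R) :
  libration X Y (2 * l) y -> (forall i, y (l - i)%Z = y i) ->
  forall i, - y i = y (l + i)%Z.
Proof.
  intros Hy Hr i. rewrite <- (lib_odd _ _ _ _ Hy), <- Hr. f_equal. ring.
Qed.

(** Oddness of [y] always makes [s] reverse time. The parity of the period or of the reflection
    index [l] decides whether the remaining symmetry of [y] is realized with or without the half
    turn. *)
Lemma typed_libration_has_type (s : D2) (h : R -> pt) (T : orbit_type) (X Y : R -> R)
    (m : Z) (y : Z -> R) :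
  symmetric_param s h -> typed_libration T X Y m y ->
  has_type T (points h y) (period T m).
Proof.
  intros Hh Hy. pose proof (param_axis _ _ Hh) as Hs.
  assert (Hb : forall i, - / 4 < y i < / 4).
  { destruct (typed_libration_libration T X Y m y Hy) as [P HP]. apply (lib_bound _ _ _ _ HP). }
  pose proof (fun i j => points_rotated s h y i j Hh Hb) as HR.
  pose proof (fun i j => points_reflected s h y i j Hh Hb) as HS.
  pose proof (fun i j => points_rotated_reflected s h y i j Hh Hb) as HRS.
  assert (Hhalf : forall a, (2 * a / 2 = a)%Z)
    by (intros a; rewrite Z.mul_comm; apply Z.div_mul; lia).
  assert (HS0 : forall i, act s (points h y i) = points h y (0 - i)).
  { intros i. apply HS. split; [exists 0%Z; ring|].
    destruct (typed_libration_libration T X Y m y Hy) as [P HP].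
    rewrite Z.sub_0_l. symmetry. apply (lib_odd _ _ _ _ HP). }
  destruct T; cbv [period typed_libration has_type] in *.
  - set (P := (2 * m + 1)%Z) in *.
    assert (HR0 : forall i, Rot (points h y i) = points h y (P + i)).
    { intros i. apply HR. split; [exists (- m)%Z; unfold P; ring|].
      rewrite Z.add_comm. symmetry. apply (lib_periodic _ _ _ _ Hy). }
    assert (HRS0 : forall i, Rot (act s (points h y i)) = points h y (P - i)).
    { intros i. apply HRS. split; [exists (- m)%Z; unfold P; ring|].
      rewrite <- (lib_odd _ _ _ _ Hy), <- (lib_periodic _ _ _ _ Hy). f_equal. ring. }
    split; [|split].
    + apply (D2_symmetric_orbit_intro s _ 0 Hs).
      * left. exists P. exact HR0.
      * exact HS0.
      * right. exists P. exact HRS0.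
    + rewrite Hhalf. exact HR0.
    + destruct (reflections s D2S Hs (or_introl eq_refl)) as [E|E].
      * exists 0%Z. intros i. rewrite E. apply HS0.
      * exists P. intros i. rewrite E. apply HRS0.
  - destruct Hy as [Hy Hr]. set (l := (2 * m + 1)%Z) in *.
    pose proof (antiperiodic_of_reflected X Y l y Hy Hr) as Ha.
    assert (HR0 : forall i, Rot (points h y i) = points h y (l - i)).
    { intros i. apply HR. split; [exists (i - m)%Z; unfold l; ring|]. now rewrite Hr. }
    assert (HRS0 : forall i, Rot (act s (points h y i)) = points h y (l + i)).
    { intros i. apply HRS. split; [exists (- i - m)%Z; unfold l; ring|]. apply Ha. }
    split; [|split].
    + apply (D2_symmetric_orbit_intro s _ 0 Hs).
      * right. exists l. exact HR0.
      * exact HS0.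
      * left. exists l. exact HRS0.
    + exists l. split; [|exact HR0].
      unfold l. rewrite Z.add_comm. now rewrite Z.odd_add_mul_2.
    + rewrite Hhalf.
      destruct Hs as [->| ->]; [right; exact HRS0|left].
      intros i. rewrite <- HRS0. simpl. now rewrite Rot_Rot.
  - destruct Hy as [Hy Hr]. set (l := (2 * m)%Z) in *.
    pose proof (antiperiodic_of_reflected X Y l y Hy Hr) as Ha.
    exists s. split; [exact Hs|]. split; [|split].
    (* All periods of [y] are multiples of [2 * l], hence even. The rotation and the other
       reflection would each yield an odd period, because [l] is even and the half turn changes the
       parity of the index. *)
    + assert (Hno : forall k, ~ Z.Even k -> ~ (forall i, y i = y (k + i)%Z)).
      { intros k Hk H. apply Hk.
        destruct (lib_minimal _ _ _ _ Hy k) as [q Hq].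
        - intros i. rewrite Z.add_comm. symmetry. apply H.
        - exists (q * l)%Z. lia. }
      assert (Hodd : forall k, Z.Even (1 - k) -> ~ Z.Even k) by (intros k [a Ha'] [b Hb']; lia).
      assert (HnR : ~ Hsym (points h y) D2R).
      { intros [[k Hk]|[k Hk]].
        - apply (Hno k).
          + apply Hodd. destruct (proj1 (HR _ _) (Hk 0%Z)) as [[a He] _]. exists a. lia.
          + intros i. apply (HR _ _), Hk.
        - apply (Hno (k - l)%Z).
          + destruct (proj1 (HR _ _) (Hk 0%Z)) as [[a He] _]. intros [b He']. unfold l in He'. lia.
          + intros i. rewrite <- (Hr i). destruct (proj1 (HR _ _) (Hk (l - i)%Z)) as [_ H].
            rewrite H. f_equal. ring. }
      assert (HnRS : ~ ((exists k, forall i, Rot (act s (points h y i)) = points h y (k + i)) \/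
                        (exists k, forall i, Rot (act s (points h y i)) = points h y (k - i)))).
      { intros [[k Hk]|[k Hk]].
        - apply (Hno (k - l)%Z).
          + destruct (proj1 (HRS _ _) (Hk 0%Z)) as [[a He] _]. intros [b He']. unfold l in He'. lia.
          + intros i. destruct (proj1 (HRS _ _) (Hk (i - l)%Z)) as [_ H].
            rewrite Ha in H. replace (l + (i - l))%Z with i in H by ring.
            rewrite H. f_equal. ring.
        - apply (Hno k).
          + apply Hodd. destruct (proj1 (HRS _ _) (Hk 0%Z)) as [[a He] _]. exists a. lia.
          + intros i. destruct (proj1 (HRS _ _) (Hk (- i)%Z)) as [_ H].
            rewrite <- (lib_odd _ _ _ _ Hy) in H. rewrite Z.opp_involutive in H.
            rewrite H. f_equal. ring. }
      intros r. split.
      * intros Hsr. destruct r; [auto|contradiction| |].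
        -- destruct Hs as [->| ->]; [auto|exfalso]. apply HnRS.
           destruct Hsr as [[k Hk]|[k Hk]]; [left|right]; exists k; intros i;
             rewrite <- Hk; simpl; now rewrite Rot_Rot.
        -- destruct Hs as [->| ->]; [exfalso|auto]. exact (HnRS Hsr).
      * intros [->| ->]; [left; exists 0%Z; reflexivity|right; exists 0%Z; exact HS0].
    + rewrite Hhalf. intros i. apply HS. split; [exists (- i - m)%Z; unfold l; ring|].
      apply Ha.
    + exists 0%Z. exact HS0.
Qed.

(** * The curvature condition *)

Lemma constant_sign (f : R -> R) (I : R -> Prop) (t0 : R) :
  (forall t, continuity_pt f t) -> I t0 ->
  (forall u v t, I u -> I v -> Rmin u v <= t <= Rmax u v -> I t) ->
  (forall t, I t -> f t <> 0) ->
  exists a, a * a = 1 /\ forall t, I t -> 0 < a * f t.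
Proof.
  intros Hc H0 HI Hf.
  assert (Hs : forall t, I t -> 0 < f t0 * f t).
  { intros t Ht. apply Rnot_le_lt. intros Hle.
    destruct (IVT_gen f t0 t 0 Hc) as [u [Hu1 Hu2]].
    - unfold Rmin, Rmax. destruct (Rle_dec (f t0) (f t)); split; nra.
    - exact (Hf u (HI _ _ _ H0 Ht Hu1) Hu2). }
  pose proof (Hf t0 H0).
  destruct (Rlt_dec 0 (f t0)); [exists 1|exists (-1)]; split; try ring;
    intros t Ht; pose proof (Hs t Ht); nra.
Qed.

Lemma chord_signs (u v : R -> R) (a b s t : R) :
  a * a = 1 -> b * b = 1 ->
  chord (fun x => a * u x) (fun x => b * v x) s t = chord u v s t.
Proof.
  intros Ha Hb. unfold chord. f_equal.
  transitivity (a * a * (u s + u t) ^ 2 + b * b * (v s + v t) ^ 2); [ring|].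
  rewrite Ha, Hb. ring.
Qed.

Lemma slope_signs (u v : R -> R) (a b s t : R) :
  a * a = 1 -> b * b = 1 ->
  slope (fun x => a * u x) (fun x => b * v x) s t = slope u v s t.
Proof.
  intros Ha Hb. unfold slope. rewrite chord_signs, !Derive_scal by assumption.
  f_equal.
  transitivity (a * a * ((u s + u t) * Derive u s) + b * b * ((v s + v t) * Derive v s)); [ring|].
  rewrite Ha, Hb. ring.
Qed.

(** By the intermediate value theorem each coordinate has constant sign on the quarter arc;
    multiplication by these signs changes neither chords nor slopes. *)
Lemma signed_arc (u v : R -> R) :
  (forall t, ex_derive u t) -> (forall t, ex_derive v t) ->
  (forall t, Derive u t <> 0 \/ Derive v t <> 0) ->
  (forall t, u (- t) = u t) -> (forall t, v (- t) = - v t) ->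
  (forall t, u (t + / 2) = - u t) -> (forall t, v (t + / 2) = - v t) ->
  (forall t, 0 <= t < / 4 -> u t <> 0) -> (forall t, 0 < t <= / 4 -> v t <> 0) ->
  exists X Y, symmetric_arc X Y /\
    (forall s t, chord X Y s t = chord u v s t) /\
    (forall s t, slope X Y s t = slope u v s t).
Proof.
  intros Hdu Hdv Him Hu Hv Huh Hvh Hun Hvn.
  destruct (constant_sign u (fun t => 0 <= t < / 4) 0) as [a [Ha Hap]]; auto.
  { intros t. apply ex_derive_continuity_pt, Hdu. }
  { lra. }
  { intros x y t. unfold Rmin, Rmax. destruct (Rle_dec x y); lra. }
  destruct (constant_sign v (fun t => 0 < t <= / 4) (/ 4)) as [b [Hb Hbp]]; auto.
  { intros t. apply ex_derive_continuity_pt, Hdv. }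
  { lra. }
  { intros x y t. unfold Rmin, Rmax. destruct (Rle_dec x y); lra. }
  exists (fun t => a * u t), (fun t => b * v t). split; [|split].
  - constructor; auto.
    + intros t. apply ex_derive_scal, Hdu.
    + intros t. apply ex_derive_scal, Hdv.
    + intros t. rewrite !Derive_scal. destruct (Him t); [left|right]; nra.
    + intros t. now rewrite Hu.
    + intros t. rewrite Hv. ring.
    + intros t. rewrite Huh. ring.
    + intros t. rewrite Hvh. ring.
  - intros s t. apply chord_signs; assumption.
  - intros s t. apply slope_signs; assumption.
Qed.

Lemma second_derivative_increase (f df : R -> R) (d r : R) :
  (forall t, is_derive f t (df t)) -> df 0 = 0 -> is_derive df 0 d -> 0 < d -> 0 < r ->
  exists e, 0 < e <= r /\ f 0 < f e.
Proof.
  intros Hf H0 Hd Hp Hr. apply is_derive_Reals in Hd.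
  destruct (Hd d Hp) as [delta Hdelta]. pose proof (cond_pos delta).
  set (e := Rmin (delta / 2) r).
  assert (He : 0 < e) by (unfold e; apply Rmin_glb_lt; lra).
  pose proof (Rmin_l (delta / 2) r : e <= _). pose proof (Rmin_r (delta / 2) r : e <= _).
  exists e. split; [lra|].
  destruct (MVT_cor2 f df 0 e He) as [c [Hc1 Hc2]].
  { intros c _. apply is_derive_Reals, Hf. }
  assert (Hc : Rabs c < delta) by (rewrite Rabs_pos_eq; lra).
  pose proof (Hdelta c ltac:(lra) Hc) as Hq. rewrite Rplus_0_l, H0 in Hq.
  apply Rabs_def2 in Hq.
  assert (Hdc : 0 < df c).
  { replace (df c) with ((df c - 0) / c * c) by (field; lra).
    apply Rmult_lt_0_compat; lra. }
  nra.
Qed.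

(** The squared distance to the center is critical at [0], and half its second derivative there is
    [u * u'' + v' ^ 2]. *)
Lemma diagonal_chord_increase (u v : R -> R) :
  (forall t, ex_derive u t) -> (forall t, ex_derive v t) ->
  ex_derive (Derive u) 0 -> ex_derive (Derive v) 0 ->
  Derive u 0 = 0 -> v 0 = 0 ->
  Rabs (u 0 * Derive (Derive u) 0) < Derive v 0 ^ 2 ->
  exists e, 0 <= e <= / 4 /\ chord u v 0 0 < chord u v e e.
Proof.
  intros Hu Hv Hu2 Hv2 Hu0 Hv0 Hlt.
  set (f := fun t => u t * u t + v t * v t).
  destruct (second_derivative_increase f
    (fun t => 2 * (u t * Derive u t + v t * Derive v t))
    (2 * (u 0 * Derive (Derive u) 0 + Derive v 0 ^ 2)) (/ 4)) as [e [He1 He2]].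
  - intros t. unfold f. auto_derive; [repeat split; auto|].
    change (Derive (fun x => u x) t) with (Derive u t).
    change (Derive (fun x => v x) t) with (Derive v t). ring.
  - rewrite Hu0, Hv0. ring.
  - auto_derive; [repeat split; auto|].
    change (fun x : R => u x) with u. change (fun x : R => v x) with v.
    change (fun x : R => Derive u x) with (Derive u).
    change (fun x : R => Derive v x) with (Derive v).
    rewrite Hu0, Hv0. ring.
  - apply Rabs_def2 in Hlt. lra.
  - lra.
  - exists e. split; [lra|]. unfold chord. apply sqrt_lt_1_alt. unfold f in *. nra.
Qed.

(** Here [a] is the position along the axis, [b] the velocity across it and [c] the acceleration
    along it. *)
Lemma curvature_condition (a b c L kappa : R) :
  b <> 0 -> L = 2 * Rabs a -> kappa = Rabs (b * c) / Rabs b ^ 3 -> kappa * L < 2 ->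
  Rabs (a * c) < b ^ 2.
Proof.
  intros Hb -> -> Hlt.
  pose proof (Rabs_pos_lt b Hb) as Hp. rewrite <- (pow2_abs b).
  rewrite Rabs_mult in *.
  replace (Rabs b * Rabs c / Rabs b ^ 3 * (2 * Rabs a))
    with (2 * ((Rabs a * Rabs c) / Rabs b ^ 2)) in Hlt by (field; lra).
  assert (H : (Rabs a * Rabs c) / Rabs b ^ 2 < 1) by lra.
  apply (Rmult_lt_compat_r (Rabs b ^ 2)) in H; [|apply pow_lt, Hp].
  replace (Rabs a * Rabs c / Rabs b ^ 2 * Rabs b ^ 2) with (Rabs a * Rabs c) in H
    by (field; lra). lra.
Qed.

Lemma even_odd_at_0 (u v : R -> R) :
  (forall t, ex_derive u t) ->
  (forall t, u (- t) = u t) -> (forall t, v (- t) = - v t) ->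
  Derive u 0 = 0 /\ v 0 = 0.
Proof.
  intros Hd Hu Hv. split.
  - pose proof (Derive_reflect u 1 0 0) as H. rewrite Rminus_0_r in H.
    enough (Derive u 0 = - (1 * Derive u 0)) by lra. apply H; [|apply Hd].
    intros t. rewrite Rminus_0_l, Hu. ring.
  - pose proof (Hv 0) as H. rewrite Ropp_0 in H. lra.
Qed.

(** A point with a zero coordinate is fixed by a reflection, and injectivity confines such
    parameters to multiples of [/ 4]. *)
Lemma param_nonvanishing (s : D2) (h : R -> pt) (t : R) :
  symmetric_param s h ->
  (0 <= t < / 4 -> h t <> Rot (act s (h t))) /\ (0 < t <= / 4 -> h t <> act s (h t)).
Proof.
  intros Hh. split; intros Ht H.
  - rewrite <- (param_opp _ _ Hh), <- (param_half _ _ Hh) in H.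
    destruct (param_inj _ _ Hh _ _ H) as [k Hk].
    assert (-1 < k < 0)%Z; [|lia]. split; apply lt_IZR; lra.
  - rewrite <- (param_opp _ _ Hh) in H.
    destruct (param_inj _ _ Hh _ _ H) as [k Hk].
    assert (0 < k < 1)%Z; [|lia]. split; apply lt_IZR; lra.
Qed.

Lemma arc_of_param (s : D2) (h : R -> pt) (L kappa : R) :
  symmetric_param s h -> C2fun (cx h) -> C2fun (cy h) ->
  (forall t, tangent h t <> (0, 0)) ->
  L = 2 * pnorm (h 0) -> curvature h 0 = kappa -> kappa * L < 2 ->
  exists X Y e, symmetric_arc X Y /\ 0 <= e <= / 4 /\
    chord X Y 0 0 < chord X Y e e /\
    (forall a b, slope X Y a b = physical_slope h a b).
Proof.
  intros Hh Hx Hy Ht HL Hk Hlt.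
  assert (Him : forall t, Derive (cx h) t <> 0 \/ Derive (cy h) t <> 0).
  { intros t. destruct (Req_dec (Derive (cx h) t) 0) as [H1|H1]; [right|left; exact H1].
    intros H2. apply (Ht t). unfold tangent. now rewrite H1, H2. }
  assert (Hex : forall f, C2fun f -> forall t, ex_derive f t) by (intros f Hf t; apply Hf).
  assert (Hex2 : forall f, C2fun f -> ex_derive (Derive f) 0) by (intros f Hf; apply Hf).
  assert (Hhalf : forall t, cx h (t + / 2) = - cx h t /\ cy h (t + / 2) = - cy h t).
  { intros t. unfold cx, cy. rewrite (param_half _ _ Hh). auto. }
  assert (Hslope : forall a b, slope (cx h) (cy h) a b = physical_slope h a b).
  { intros a b. unfold slope, physical_slope, chord, pnorm, dot, padd, tangent, cx, cy. simpl.
    now rewrite !Rmult_1_r. }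
  assert (Hslope' : forall a b, slope (cy h) (cx h) a b = physical_slope h a b).
  { intros a b. rewrite <- Hslope. unfold slope, chord.
    rewrite (Rplus_comm ((cy h a + cy h b) ^ 2)), (Rplus_comm ((cy h a + cy h b) * _)).
    reflexivity. }
  (* [u] is the even coordinate, along the axis of [s], and [v] the odd one: the first and second
     coordinates for [D2S], swapped for [D2RS]. *)
  enough (H : exists u v, (forall a b, slope u v a b = physical_slope h a b) /\
    C2fun u /\ C2fun v /\ (forall t, Derive u t <> 0 \/ Derive v t <> 0) /\
    (forall t, u (- t) = u t) /\ (forall t, v (- t) = - v t) /\
    (forall t, u (t + / 2) = - u t) /\ (forall t, v (t + / 2) = - v t) /\
    (forall t, 0 <= t < / 4 -> u t <> 0) /\ (forall t, 0 < t <= / 4 -> v t <> 0) /\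
    Rabs (u 0 * Derive (Derive u) 0) < Derive v 0 ^ 2).
  { destruct H as [u [v [Hs [Hu [Hv [Hi [Hu1 [Hv1 [Hu2 [Hv2 [Hu3 [Hv3 Hc]]]]]]]]]]]].
    destruct (signed_arc u v) as [X [Y [HA [Hch Hsl]]]]; auto.
    destruct (even_odd_at_0 u v) as [Hdu Hv0]; auto.
    destruct (diagonal_chord_increase u v) as [e [He1 He2]]; auto.
    exists X, Y, e. rewrite !Hch.
    split; [exact HA|]. split; [exact He1|]. split; [exact He2|].
    intros a b. now rewrite Hsl. }
  pose proof (fun t => proj1 (Hhalf t)) as Hhx. pose proof (fun t => proj2 (Hhalf t)) as Hhy.
  unfold curvature, pnorm, dot, tangent in *. simpl fst in *. simpl snd in *.
  destruct (param_axis _ _ Hh) as [-> | ->].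
  - assert (E1 : forall t, cx h (- t) = cx h t) by (intros t; unfold cx; now rewrite (param_opp _ _ Hh)).
    assert (E2 : forall t, cy h (- t) = - cy h t) by (intros t; unfold cy; now rewrite (param_opp _ _ Hh)).
    destruct (even_odd_at_0 (cx h) (cy h)) as [D1 D2]; auto.
    exists (cx h), (cy h). repeat (split; [solve [auto]|]). split; [|split].
    + intros t H1 H2. apply (proj1 (param_nonvanishing _ _ t Hh) H1).
      apply injective_projections; simpl; unfold cx in H2; lra.
    + intros t H1 H2. apply (proj2 (param_nonvanishing _ _ t Hh) H1).
      apply injective_projections; simpl; unfold cy in H2; lra.
    + apply (curvature_condition _ (Derive (cy h) 0) _ L kappa); auto.
      * destruct (Him 0); congruence.
      * rewrite HL. unfold cy in D2. rewrite D2, <- sqrt_Rsqr_abs. f_equal. f_equal.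
        unfold Rsqr, cx. ring.
      * rewrite <- Hk, D1. rewrite <- (sqrt_Rsqr_abs (Derive (cy h) 0)), <- (Rabs_Ropp (_ * _)).
        unfold Rsqr. f_equal; [f_equal; ring|]. f_equal. f_equal. ring.
  - assert (E1 : forall t, cx h (- t) = - cx h t) by (intros t; unfold cx; now rewrite (param_opp _ _ Hh)).
    assert (E2 : forall t, cy h (- t) = cy h t).
    { intros t. unfold cy. rewrite (param_opp _ _ Hh). simpl. ring. }
    destruct (even_odd_at_0 (cy h) (cx h)) as [D1 D2]; auto.
    exists (cy h), (cx h). repeat (split; [solve [auto | intros t; destruct (Him t); auto]|]). split; [|split].
    + intros t H1 H2. apply (proj1 (param_nonvanishing _ _ t Hh) H1).
      apply injective_projections; simpl; unfold cy in H2; lra.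
    + intros t H1 H2. apply (proj2 (param_nonvanishing _ _ t Hh) H1).
      apply injective_projections; simpl; unfold cx in H2; lra.
    + apply (curvature_condition _ (Derive (cx h) 0) _ L kappa); auto.
      * destruct (Him 0); congruence.
      * rewrite HL. unfold cx in D2. rewrite D2, <- sqrt_Rsqr_abs. f_equal. f_equal.
        unfold Rsqr, cy. ring.
      * rewrite <- Hk, D1. rewrite <- (sqrt_Rsqr_abs (Derive (cx h) 0)).
        unfold Rsqr. f_equal; [f_equal; ring|]. f_equal. f_equal. ring.
Qed.

(** * Moving the origin of the parameter to the two-periodic orbit *)

Definition shifted (g : R -> pt) (c t : R) : pt := g (t + c).

Lemma tangent_shifted (g : R -> pt) (c t : R) : tangent (shifted g c) t = tangent g (t + c).
Proof.
  unfold tangent. rewrite <- (Derive_shift (cx g)), <- (Derive_shift (cy g)). reflexivity.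
Qed.

Lemma C2fun_shift (f : R -> R) (c : R) : C2fun f -> C2fun (fun t => f (t + c)).
Proof.
  intros Hf t.
  assert (Hex : forall (k : R -> R) (u : R), ex_derive k (u + c) -> ex_derive (fun x => k (x + c)) u).
  { intros k u H. apply (ex_derive_comp k (fun x => x + c)); [exact H|].
    auto_derive. exact I. }
  assert (E1 : forall u, Derive f (u + c) = Derive (fun x => f (x + c)) u)
    by (intros u; symmetry; apply Derive_shift).
  assert (E2 : forall u, Derive (Derive f) (u + c) = Derive (Derive (fun x => f (x + c))) u).
  { intros u. rewrite <- Derive_shift. apply Derive_ext. exact E1. }
  split; [apply Hex, Hf|]. split.
  - apply (ex_derive_ext (fun u => Derive f (u + c)) _ t E1). apply Hex, Hf.
  - apply (continuous_ext (fun u => Derive (Derive f) (u + c)) _ t E2).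
    apply (continuous_comp (fun u => u + c) (Derive (Derive f))); [|apply Hf].
    apply (continuous_plus (V := R_NormedModule)); [apply continuous_id|apply continuous_const].
Qed.

Lemma curvature_shifted (g : R -> pt) (c t : R) :
  curvature (shifted g c) t = curvature g (t + c).
Proof.
  assert (E : forall f : R -> R, Derive (Derive (fun x => f (x + c))) t = Derive (Derive f) (t + c)).
  { intros f. rewrite <- Derive_shift. apply Derive_ext. intros u. apply Derive_shift. }
  unfold curvature. rewrite tangent_shifted.
  rewrite <- (E (cx g)), <- (E (cy g)), <- (Derive_shift (cx g)), <- (Derive_shift (cy g)).
  reflexivity.
Qed.

Lemma billiard_orbit_shifted (g : R -> pt) (c : R) (z : Z -> pt) :
  billiard_orbit (shifted g c) z -> billiard_orbit g z.
Proof.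
  intros [H1 [H2 H3]]. split; [|split; [exact H2|]].
  - intros i. destruct (H1 i) as [t Ht]. now exists (t + c).
  - intros i t Ht. replace t with (t - c + c) by ring. rewrite <- tangent_shifted.
    apply H3. unfold shifted. now replace (t - c + c) with t by ring.
Qed.

Lemma rotation_number_shifted (g : R -> pt) (c : R) (z : Z -> pt) (rho : R) :
  rotation_number (shifted g c) z rho -> rotation_number g z rho.
Proof.
  intros [x [Hx Hr]]. exists (fun i => x i + c). split.
  - intros i. destruct (Hx i). split; [assumption|lra].
  - intros e He. destruct (Hr e He) as [N HN]. exists N. intros n Hn.
    replace (x (Z.of_nat n) + c - (x 0%Z + c)) with (x (Z.of_nat n) - x 0%Z) by ring. auto.
Qed.

Lemma birkhoff_orbit_shifted (g : R -> pt) (c : R) (z : Z -> pt) :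
  birkhoff_orbit g z -> birkhoff_orbit (shifted g c) z.
Proof.
  intros [x [Hx Hb]]. exists (fun i => x i - c). split.
  - intros i. destruct (Hx i). split; [|lra].
    unfold shifted. now replace (x i - c + c) with (x i) by ring.
  - intros i j m l H. pose proof (Hb i j m l ltac:(lra)). lra.
Qed.

Lemma curve_periodic (g : R -> pt) (k : Z) (t : R) :
  (forall t, g (t + / 2) = Rot (g t)) -> g (t + IZR k) = g t.
Proof.
  intros H. replace (t + IZR k) with (IZR (2 * k) / 2 + t) by (rewrite mult_IZR; field).
  assert (E : parity_sign (2 * k) = 1).
  { unfold parity_sign. replace (Z.even (2 * k)) with true; [reflexivity|].
    symmetry. apply Z.even_spec. now exists k. }
  apply injective_projections.
  - rewrite (half_turns (fun t => fst (g t))), E by (intros u; now rewrite H). ring.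
  - rewrite (half_turns (fun t => snd (g t))), E by (intros u; now rewrite H). ring.
Qed.

Lemma curve_injective_mod_1 (g : R -> pt) (u t : R) :
  (forall t, g (t + / 2) = Rot (g t)) ->
  (forall s t, 0 <= s < 1 -> 0 <= t < 1 -> g s = g t -> s = t) ->
  g u = g t -> exists k, u = t + IZR k.
Proof.
  intros Hh Hi H.
  assert (E : forall x, g (frac_part x) = g x).
  { intros x. unfold frac_part.
    replace (x - IZR (Int_part x)) with (x + IZR (- Int_part x)) by (rewrite opp_IZR; ring).
    now apply curve_periodic. }
  assert (Hf : frac_part u = frac_part t).
  { apply Hi.
    - destruct (base_fp u). lra.
    - destruct (base_fp t). lra.
    - now rewrite !E. }
  exists (Int_part u - Int_part t)%Z. rewrite minus_IZR. unfold frac_part in Hf. lra.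
Qed.

(** Every symmetry permutes the two points. The rotation fixes no point of the curve, so it
    exchanges them and [L] is twice the distance to the center. The reflection [D2S] fixes them or
    exchanges them; in the latter case [D2RS] fixes them. *)
Lemma two_periodic_on_axis (g : R -> pt) (z : Z -> pt) (L : R) :
  billiard_curve g -> D2_symmetric_curve g -> billiard_orbit g z ->
  periodic_min z 2%Z -> D2_symmetric_orbit z ->
  (forall i, pdist (z i) (z (i + 1)%Z) = L) ->
  exists s c i, symmetric_param s (shifted g c) /\ g c = z i /\ L = 2 * pnorm (g c).
Proof.
  intros [_ [_ [_ [_ [Hinj _]]]]] [Hhalf Hopp] [Hon _] [_ [Hper _]] Hsym HL.
  pose proof (fun u t => curve_injective_mod_1 g u t Hhalf Hinj) as Hmod.
  destruct (Hon 0%Z) as [t Ht].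
  assert (Hz2 : forall q i, z (i + 2 * q)%Z = z i).
  { intros q i. induction q as [|q IH|q IH] using Z.peano_ind.
    - f_equal. ring.
    - rewrite <- IH, <- (Hper (i + 2 * q)%Z). f_equal. unfold Z.succ. ring.
    - rewrite <- IH, <- Hper. f_equal. unfold Z.pred. ring. }
  assert (Hz : forall k, z k = z 0%Z \/ z k = z 1%Z).
  { intros k. destruct (Z.Even_or_Odd k) as [[a Ha]|[a Ha]]; [left|right].
    - rewrite <- (Hz2 a 0%Z). f_equal. lia.
    - rewrite <- (Hz2 a 1%Z). f_equal. lia. }
  assert (Himage : forall r, act r (z 0%Z) = z 0%Z \/ act r (z 0%Z) = z 1%Z).
  { intros r. destruct (Hsym r) as [[k Hk]|[k Hk]]; rewrite Hk; apply Hz. }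
  assert (HR : Rot (z 0%Z) = z 1%Z).
  { destruct (Himage D2R) as [H|H]; [exfalso|exact H]. simpl in H.
    rewrite <- Ht, <- Hhalf in H. destruct (Hmod _ _ H) as [k Hk].
    assert (0 < k < 1)%Z; [|lia]. split; apply lt_IZR; lra. }
  assert (Hquarter : forall u, shifted g (/ 4) (- u) = act D2RS (shifted g (/ 4) u)).
  { intros u. unfold shifted. simpl. rewrite <- Hopp, <- Hhalf. f_equal. field. }
  assert (Hinj' : forall c u v, shifted g c u = shifted g c v -> exists k, u = v + IZR k).
  { intros c u v H. destruct (Hmod _ _ H) as [k Hk]. exists k. lra. }
  assert (Hhalf' : forall c u, shifted g c (u + / 2) = Rot (shifted g c u)).
  { intros c u. unfold shifted. rewrite <- Hhalf. f_equal. ring. }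
  assert (Hc : exists s c j, symmetric_param s (shifted g c) /\ c = t + IZR j / 2).
  { destruct (Himage D2S) as [H|H]; simpl in H.
    - rewrite <- Ht, <- Hopp in H. destruct (Hmod _ _ H) as [k Hk].
      exists D2S, 0, k. split; [|lra]. constructor; auto; [|apply Hinj'].
      intros u. unfold shifted. now rewrite !Rplus_0_r.
    - rewrite <- HR, <- Ht, <- Hopp, <- Hhalf in H. destruct (Hmod _ _ H) as [k Hk].
      exists D2RS, (/ 4), (k + 1)%Z. split; [|rewrite plus_IZR; lra]. constructor; auto.
      apply Hinj'. }
  destruct Hc as [s [c [j [Hs Hcj]]]].
  assert (Hi : exists i, g c = z i).
  { destruct (Z.Even_or_Odd j) as [[a Ha]|[a Ha]].
    - exists 0%Z. rewrite <- Ht, <- (curve_periodic g a t Hhalf). f_equal.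
      rewrite Hcj, Ha, mult_IZR. field.
    - exists 1%Z. rewrite <- HR, <- Ht, <- Hhalf, <- (curve_periodic g a (t + / 2) Hhalf). f_equal.
      rewrite Hcj, Ha, plus_IZR, mult_IZR. field. }
  destruct Hi as [i Hi]. exists s, c, i. split; [exact Hs|]. split; [exact Hi|].
  assert (Hnext : z (i + 1)%Z = Rot (z i)).
  { destruct (Z.Even_or_Odd i) as [[a Ha]|[a Ha]].
    - replace (z (i + 1)%Z) with (z 1%Z) by (rewrite <- (Hz2 a 1%Z); f_equal; lia).
      replace (z i) with (z 0%Z) by (rewrite <- (Hz2 a 0%Z); f_equal; lia). auto.
    - replace (z (i + 1)%Z) with (z 0%Z) by (rewrite <- (Hz2 (a + 1)%Z 0%Z); f_equal; lia).
      replace (z i) with (z 1%Z) by (rewrite <- (Hz2 a 1%Z); f_equal; lia).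
      rewrite <- HR. symmetry. apply Rot_Rot. }
  rewrite <- (HL i), Hnext, Hi. unfold pdist, pnorm.
  replace 2 with (sqrt (2 * 2)) by (apply sqrt_square; lra).
  rewrite <- sqrt_mult_alt by lra. f_equal. unfold dot, psub, Rot. simpl. ring.
Qed.

Theorem mainTheorem4 (g : R -> pt) (Z0 : Z -> pt) (L kappa : R) :
  billiard_curve g -> D2_symmetric_curve g ->
  billiard_orbit g Z0 -> periodic_min Z0 2%Z ->
  D2_symmetric_orbit Z0 -> birkhoff_orbit g Z0 ->
  (forall i, pdist (Z0 i) (Z0 (i + 1)%Z) = L) ->
  (forall i t, g t = Z0 i -> curvature g t = kappa) ->
  kappa * L < 2 ->
  forall (T : orbit_type) (N : Z), exists (z : Z -> pt) (p : Z),
    (N < p)%Z /\ billiard_orbit g z /\ periodic_min z p /\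
    rotation_number g z (/ 2) /\ ~ birkhoff_orbit g z /\ has_type T z p.
Proof.
  intros Hg Hsym Horb Hper HD2 _ HL Hk Hlt T N.
  destruct (two_periodic_on_axis g Z0 L Hg Hsym Horb Hper HD2 HL)
    as [s [c [i [Hh [Hc HLc]]]]].
  destruct Hg as [Hx [Hy [Htan _]]]. set (h := shifted g c) in *.
  destruct (arc_of_param s h L kappa Hh) as [X [Y [e [HA [He [Hlong Hslope]]]]]].
  - exact (C2fun_shift (cx g) c Hx).
  - exact (C2fun_shift (cy g) c Hy).
  - intros t. unfold h. rewrite tangent_shifted. apply Htan.
  - rewrite HLc. unfold h, shifted. now rewrite Rplus_0_l.
  - unfold h. rewrite curvature_shifted, Rplus_0_l. exact (Hk i c Hc).
  - exact Hlt.
  - destruct (long_librations X Y e T HA He Hlong) as [m0 Hm0].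
    (* Every [period T m] is at least [4 * m], which exceeds [N] as [m] is at least [1] and [N]. *)
    set (m := Z.max m0 (Z.max 1 N)).
    destruct (Hm0 m ltac:(lia)) as [y Hty].
    destruct (typed_libration_libration T X Y m y Hty) as [P HP].
    exists (points h y), (period T m). split; [|split; [|split; [|split; [|split]]]].
    + destruct T; unfold period; lia.
    + apply (billiard_orbit_shifted g c). exact (libration_billiard s h X Y P y Hh Hslope HP).
    + apply (typed_libration_period s h T X Y m y Hh); [lia|exact Hty].
    + apply (rotation_number_shifted g c). exact (libration_rotation h X Y P y HP).
    + intros Hb. apply (libration_not_birkhoff s h X Y P y Hh HP).
      exact (birkhoff_orbit_shifted g c _ Hb).
    + exact (typed_libration_has_type s h T X Y m y Hh Hty).
Qed.
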